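(* Let $T$ be a positive isometry on an infinite-dimensional complex Banach lattice $L$. If $F(T)$ is finite-dimensional, then $T$ is not uniformly ergodic.
   Context: $F(T)=\{f\in L: Tf=f\}$. An isometry is a linear operator with $\|Tf\|=\|f\|$ for all $f$ (not assumed surjective). $T$ is uniformly ergodic if $\frac1n\sum_{k=1}^nT^k$ converges in operator norm. *)

(* Defs.v *)
From HB Require Import structures.
From mathcomp Require Import all_boot all_order all_algebra.
From mathcomp Require Import complex.
From mathcomp Require Import all_classical all_reals all_analysis.

Set Implicit Arguments.
Unset Strict Implicit.
Unset Printing Implicit Defensive.

Import Order.TTheory GRing.Theory Num.Theory.
Import numFieldNormedType.Exports.

Local Open Scope classical_set_scope.
Local Open Scope ring_scope.
Local Open Scope complex_scope.

Definition is_lub (T : Type) (le : rel T) (A : set T) (m : T) : Prop :=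
  (forall x, A x -> le x m) /\
  (forall u, (forall x, A x -> le x u) -> le m u).

(* The order is a field of the record because the MathComp hierarchy has no
   join of normed modules with ordered types: the ordered normed structures
   available there are all number domains. *)
Record banachLattice (R : realType) := BanachLattice {
  bl_space :> completeNormedModType R;
  bl_le : rel bl_space;
  bl_join : bl_space -> bl_space -> bl_space;
  bl_le_refl : reflexive bl_le;
  bl_le_anti : antisymmetric bl_le;
  bl_le_trans : transitive bl_le;
  bl_joinP : forall x y, is_lub bl_le [set x; y] (bl_join x y);
  bl_leD2r : forall x y z, bl_le x y -> bl_le (x + z) (y + z);
  bl_scale_ge0 : forall (a : R) x, 0 <= a -> bl_le 0 x -> bl_le 0 (a *: x);
  bl_norm_le : forall x y,
    bl_le (bl_join x (- x)) (bl_join y (- y)) -> `|x| <= `|y|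
}.

(* A complex Banach lattice is the complexification E (+) iE of a real Banach
   lattice E, with modulus |x + iy| = sup_t (cos t x + sin t y), t real, and
   norm ||z|| = || |z| ||.  This modulus always exists in a Banach lattice, so
   the existential in [cbl_norm] does not restrict E. *)
Record complexBanachLattice (R : realType) := ComplexBanachLattice {
  cbl_space :> completeNormedModType R[i];
  cbl_real : banachLattice R;
  cbl_emb : cbl_real -> cbl_space;
  cbl_embD : forall x y, cbl_emb (x + y) = cbl_emb x + cbl_emb y;
  cbl_embZ : forall (a : R) x, cbl_emb (a *: x) = a%:C *: cbl_emb x;
  cbl_emb_bij :
    bijective (fun p : cbl_real * cbl_real => cbl_emb p.1 + 'i *: cbl_emb p.2);
  cbl_norm : forall x y : cbl_real, exists2 m : cbl_real,
    is_lub (@bl_le R cbl_real) (range (fun t : R => cos t *: x + sin t *: y)) m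
    & `|cbl_emb x + 'i *: cbl_emb y| = `|m|%:C
}.

Definition positive_operator (R : realType) (L : complexBanachLattice R)
    (T : L -> L) : Prop :=
  forall x : cbl_real L, bl_le 0 x ->
    exists2 y : cbl_real L, bl_le 0 y & T (cbl_emb x) = cbl_emb y.

Definition isometry_operator (K : numFieldType) (V : normedModType K)
    (T : V -> V) : Prop :=
  forall f, `|T f| = `|f|.

Definition fixed_space (V : Type) (T : V -> V) : set V := [set f | T f = f].

(* Meant for linear subspaces A. *)
Definition finite_dimensional (K : fieldType) (V : lmodType K) (A : set V) :
    Prop :=
  exists (n : nat) (b : 'I_n -> V),
    A = range (fun c : 'I_n -> K => \sum_(i < n) c i *: b i).

Definition infinite_dimensional (K : fieldType) (V : lmodType K) : Prop :=
  ~ finite_dimensional [set: V].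

(* Norms over R[i] take their values in R[i]; they are real, whence Re. *)
Definition opnorm (R : realType) (V : normedModType R[i]) (S : V -> V) :
    \bar R :=
  ereal_sup [set (complex.Re `|S f|)%:E | f in [set f : V | `|f| <= 1]].

Definition cesaro_mean (K : numFieldType) (V : normedModType K) (T : V -> V)
    (n : nat) : V -> V :=
  fun f => n%:R^-1 *: \sum_(1 <= k < n.+1) iter k T f.

Definition uniformly_ergodic (R : realType) (V : normedModType R[i])
    (T : V -> V) : Prop :=
  exists P : {linear V -> V}, continuous P /\
    opnorm (fun f => cesaro_mean T n f - P f) @[n --> \oo] --> 0%E.

(* Main.v *)
Require Import Defs.
From HB Require Import structures.
From mathcomp Require Import all_boot all_order all_algebra.
From mathcomp Require Import complex.
From mathcomp Require Import all_classical all_reals all_analysis.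
From mathcomp Require Import ring lra.

Import Order.TTheory GRing.Theory Num.Theory.
Import numFieldNormedType.Exports.

Local Open Scope classical_set_scope.
Local Open Scope ring_scope.

Set Implicit Arguments.
Unset Strict Implicit.
Unset Printing Implicit Defensive.

(** Suppose the averages of [T] converge in norm to [P]; then [P] is a positive
    projection onto the fixed space, which has finite dimension. The claim is
    that the lattice is then finite-dimensional. Everything takes place in the
    real lattice [E], where [T] and [P] restrict to linear maps.

    Uniform ergodicity makes the partial sums of [T^i] bounded on the kernel of
    [P]. For positive [x] the positive vector [m T^(m-1) x], of norm [m |x|], is
    dominated by the square of such a partial sum applied to [x]; hence [|P x|]
    is at least a fixed multiple of [|x|] on the positive cone
    ([P_lower_bound]). As [P] has finite-dimensional range, the norm is then
    additive up to a constant on the positive cone ([norm_superadditive]), as in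
    an L1 space.

    If [T] preserved lattice operations the proof would end as follows. Choose a
    fixed [e] above [P x] for all [x] in the unit ball. An average of a positive
    [x] of norm one is close to [P x], so one of finitely many vectors
    [meet (T^k x) e = T^k (meet x e)] has norm bounded below, and so does
    [meet x e]. For disjoint [x i] the vectors [meet (x i) e] add up to at most
    [e], so by additivity of the norm there are only boundedly many of them, and
    a vector lattice with this property is finite-dimensional.

    A positive isometry need not preserve lattice operations, but it does so in
    the limit: [P |T^n x|] decreases in a finite-dimensional space, hence
    converges, and by the lower bound on [P] the defect
    [T^k |T^n x| - |T^(n+k) x|] tends to zero uniformly in [k]. The argument is thus carried out in the
    lattice of asymptotic orbits, the sequences [x] with [T^k (x n)] uniformly
    close to [x (n + k)], under the seminorm [lim |x n|]
    ([asymptotic_orbit_abs], [limit_norm_meet], [disjoint_systems_bounded]).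
    Disjoint systems there are bounded in size, so finitely many atoms span it
    modulo null sequences ([bounded_disjoint_systems_span]). Because [T] is an
    isometry, [f |-> (T^n f)_n] embeds [E] isometrically, and [E] is
    finite-dimensional. *)

(** * Vector lattices *)

(** The order takes values in [Prop], so that the pointwise order on sequences
    of a Banach lattice is an instance as well. *)
Record vectorLattice (R : realFieldType) := VectorLattice {
  vl_space :> lmodType R;
  vle : vl_space -> vl_space -> Prop;
  vjoin : vl_space -> vl_space -> vl_space;
  vle_refl : forall x, vle x x;
  vle_anti : forall x y, vle x y -> vle y x -> x = y;
  vle_trans : forall y x z, vle x y -> vle y z -> vle x z;
  vle_joinl : forall x y, vle x (vjoin x y);
  vle_joinr : forall x y, vle y (vjoin x y);
  vjoin_le : forall x y z, vle x z -> vle y z -> vle (vjoin x y) z;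
  vleD2r : forall z x y, vle x y -> vle (x + z) (y + z);
  vscale_ge0 : forall (a : R) x, 0 <= a -> vle 0 x -> vle 0 (a *: x)
}.

Arguments vle_trans {R v y x z}.
Arguments vleD2r {R v} z {x y}.

Section VectorLatticeTheory.
Variables (R : realFieldType) (V : vectorLattice R).
Implicit Types (x y z u v w : V) (a b : R).

Local Notation "x [<=] y" := (vle x y) (at level 70, no associativity).

Definition vmeet x y : V := - vjoin (- x) (- y).
Definition vabs x : V := vjoin x (- x).
Definition vpos x : V := vjoin x 0.

Hint Resolve vle_refl : core.

Lemma vle_subl x y z : x [<=] y + z -> x - z [<=] y.
Proof. by move=> h; have := vleD2r (- z) h; rewrite addrK. Qed.

Lemma vle_addr x y z : x - z [<=] y -> x [<=] y + z.
Proof. by move=> h; have := vleD2r z h; rewrite subrK. Qed.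

Lemma vsub_ge0 x y : x [<=] y -> 0 [<=] y - x.
Proof. by move=> h; have := vleD2r (- x) h; rewrite subrr. Qed.

Lemma vle_of_sub x y : 0 [<=] y - x -> x [<=] y.
Proof. by move=> h; have := vleD2r x h; rewrite add0r subrK. Qed.

Lemma vleD x y u v : x [<=] y -> u [<=] v -> x + u [<=] y + v.
Proof.
move=> h1 h2; apply: vle_trans (vleD2r u h1) _.
by rewrite ![y + _]addrC; exact: vleD2r.
Qed.

Lemma vleN x y : x [<=] y -> - y [<=] - x.
Proof. by move=> /vsub_ge0 h; apply: vle_of_sub; rewrite opprK addrC. Qed.

Lemma vadd_ge0 x y : 0 [<=] x -> 0 [<=] y -> 0 [<=] x + y.
Proof. by move=> h1 h2; rewrite -[0]addr0; exact: vleD. Qed.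

Lemma vle_add x y : 0 [<=] y -> x [<=] x + y.
Proof. by move=> h; rewrite -{1}[x]addr0; apply: vleD. Qed.

Lemma vleZ a x y : 0 <= a -> x [<=] y -> a *: x [<=] a *: y.
Proof.
by move=> a0 /vsub_ge0 h; apply: vle_of_sub; rewrite -scalerBr; exact: vscale_ge0.
Qed.

Lemma vleZl a b x : a <= b -> 0 [<=] x -> a *: x [<=] b *: x.
Proof.
move=> ab h; apply: vle_of_sub; rewrite -scalerBl.
by apply: vscale_ge0 => //; rewrite subr_ge0.
Qed.

Lemma vsum_ge0 (I : Type) (r : seq I) (Q : pred I) (f : I -> V) :
  (forall i, Q i -> 0 [<=] f i) -> 0 [<=] \sum_(i <- r | Q i) f i.
Proof. by move=> h; elim/big_ind: _ => // *; exact: vadd_ge0. Qed.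

Lemma vle_sum (I : Type) (r : seq I) (Q : pred I) (f g : I -> V) :
  (forall i, Q i -> f i [<=] g i) ->
  \sum_(i <- r | Q i) f i [<=] \sum_(i <- r | Q i) g i.
Proof. by move=> h; elim/big_ind2: _ => // *; exact: vleD. Qed.

Lemma vmeet_lel x y : vmeet x y [<=] x.
Proof. by rewrite -{2}[x]opprK; apply/vleN/vle_joinl. Qed.

Lemma vmeet_ler x y : vmeet x y [<=] y.
Proof. by rewrite -{2}[y]opprK; apply/vleN/vle_joinr. Qed.

Lemma vle_meet z x y : z [<=] x -> z [<=] y -> z [<=] vmeet x y.
Proof.
by move=> h1 h2; rewrite -[z]opprK; apply/vleN/vjoin_le; exact: vleN.
Qed.

Lemma vmeetC x y : vmeet x y = vmeet y x.
Proof.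
by apply: vle_anti; apply: vle_meet; (exact: vmeet_lel || exact: vmeet_ler).
Qed.

Lemma vle_meet2 x y u v : x [<=] u -> y [<=] v -> vmeet x y [<=] vmeet u v.
Proof.
move=> h1 h2; apply: vle_meet.
  exact: vle_trans (vmeet_lel _ _) h1.
exact: vle_trans (vmeet_ler _ _) h2.
Qed.

Lemma vmeet_ge0 x y : 0 [<=] x -> 0 [<=] y -> 0 [<=] vmeet x y.
Proof. exact: vle_meet. Qed.

Lemma vjoinD x y z : vjoin x y + z = vjoin (x + z) (y + z).
Proof.
apply: vle_anti; last first.
  by apply: vjoin_le; apply: vleD2r; [exact: vle_joinl|exact: vle_joinr].
suff /(vleD2r z) : vjoin x y [<=] vjoin (x + z) (y + z) - z by rewrite subrK.
by apply: vjoin_le; rewrite -[X in X [<=] _](addrK z); apply: vleD2r;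
  [exact: vle_joinl|exact: vle_joinr].
Qed.

Lemma vmeetD x y z : vmeet x y + z = vmeet (x + z) (y + z).
Proof. by rewrite /vmeet !opprD -vjoinD opprD opprK. Qed.

Lemma vjoin_meet x y : vjoin x y + vmeet x y = x + y.
Proof.
rewrite /vmeet; apply/eqP; rewrite subr_eq addrC vjoinD addKr.
have -> : - y + (x + y) = x by rewrite [x + y]addrC addKr.
by apply/eqP; apply: vle_anti;
  apply: vjoin_le; (exact: vle_joinl || exact: vle_joinr).
Qed.

Lemma vjoinZ a x y : 0 <= a -> a *: vjoin x y = vjoin (a *: x) (a *: y).
Proof.
move=> a0; have [->|an0] := eqVneq a 0.
  by rewrite !scale0r; apply: vle_anti; [exact: vle_joinl|exact: vjoin_le].
have le_joinZ b u v : 0 <= b -> vjoin (b *: u) (b *: v) [<=] b *: vjoin u v.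
  by move=> b0; apply: vjoin_le; apply: vleZ => //;
    [exact: vle_joinl|exact: vle_joinr].
apply: vle_anti; last exact: le_joinZ.
have ai0 : 0 <= a^-1 by rewrite invr_ge0.
have := vleZ a0 (le_joinZ a^-1 (a *: x) (a *: y) ai0).
by rewrite !scalerA mulVf // mulfV // !scale1r.
Qed.

Lemma vmeetZ a x y : 0 <= a -> a *: vmeet x y = vmeet (a *: x) (a *: y).
Proof. by move=> a0; rewrite /vmeet scalerN vjoinZ // !scalerN. Qed.

(** ** Absolute value and positive part *)

Lemma vle_abs x : x [<=] vabs x.
Proof. exact: vle_joinl. Qed.

Lemma vleN_abs x : - x [<=] vabs x.
Proof. exact: vle_joinr. Qed.

Lemma vabs_le x y : x [<=] y -> - x [<=] y -> vabs x [<=] y.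
Proof. exact: vjoin_le. Qed.

Lemma vjoinC x y : vjoin x y = vjoin y x.
Proof.
by apply: vle_anti; apply: vjoin_le; (exact: vle_joinl || exact: vle_joinr).
Qed.

Lemma vabsN x : vabs (- x) = vabs x.
Proof. by rewrite /vabs opprK vjoinC. Qed.

Lemma vhalf_ge0 x : 0 [<=] x + x -> 0 [<=] x.
Proof.
move=> /(vscale_ge0 (a := 2^-1)); rewrite invr_ge0 ler0n => /(_ isT).
by rewrite -[x + x]/(x *+ 2) -(scaler_nat 2 x) scalerA mulVf ?scale1r ?pnatr_eq0.
Qed.

Lemma vabs_ge0 x : 0 [<=] vabs x.
Proof.
apply: vhalf_ge0; rewrite -(subrr x); apply: vleD; first exact: vle_abs.
exact: vleN_abs.
Qed.

Lemma vabs_id x : 0 [<=] x -> vabs x = x.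
Proof.
move=> x0; apply: vle_anti; last exact: vle_abs.
apply: vabs_le => //; apply: (vle_trans _ x0).
by rewrite -oppr0; exact: vleN.
Qed.

Lemma vabs_abs x : vabs (vabs x) = vabs x.
Proof. exact/vabs_id/vabs_ge0. Qed.

Lemma vabsD x y : vabs (x + y) [<=] vabs x + vabs y.
Proof.
apply: vabs_le; rewrite ?opprD; apply: vleD;
  (exact: vle_abs || exact: vleN_abs).
Qed.

Lemma vabs_distC x y : vabs (x - y) = vabs (y - x).
Proof. by rewrite -vabsN opprB. Qed.

Lemma vabs_dist x y z : x [<=] y + z -> y [<=] x + z -> vabs (x - y) [<=] z.
Proof.
move=> h1 h2; apply: vabs_le; rewrite ?opprB; apply: vle_subl.
  by rewrite addrC.
by rewrite addrC.
Qed.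

Lemma vle_dist x y : x [<=] y + vabs (x - y).
Proof. by have := vleD2r y (vle_abs (x - y)); rewrite subrK addrC. Qed.

Lemma vabs_distabs x y : vabs (vabs x - vabs y) [<=] vabs (x - y).
Proof.
have h u v : vabs u [<=] vabs v + vabs (u - v).
  by rewrite -{1}(subrK v u) addrC; exact: vabsD.
by apply: vabs_dist => //; rewrite vabs_distC.
Qed.

Lemma vabsZ a x : vabs (a *: x) = `|a| *: vabs x.
Proof.
wlog a0 : a / 0 <= a => [h|].
  have [a0|/ltW a0] := leP 0 a; first exact: h.
  by rewrite -vabsN -scaleNr -normrN h ?oppr_ge0.
by rewrite ger0_norm // /vabs vjoinZ // scalerN.
Qed.

Lemma vjoin_abs x y : vjoin x y = 2^-1 *: (x + y + vabs (x - y)).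
Proof.
have -> : x + y + vabs (x - y) = 2 *: vjoin x y.
  rewrite /vabs addrC vjoinD opprB addrACA [- y + y]addrC subrr addr0.
  rewrite [x + y]addrC addrACA [- x + x]addrC subrr addr0.
  by rewrite vjoinZ // !scaler_nat !mulr2n.
by rewrite scalerA mulVf ?scale1r ?pnatr_eq0.
Qed.

Lemma vpos_ge0 x : 0 [<=] vpos x.
Proof. exact: vle_joinr. Qed.

Lemma vle_pos x : x [<=] vpos x.
Proof. exact: vle_joinl. Qed.

Lemma vpos_le x y : x [<=] y -> 0 [<=] y -> vpos x [<=] y.
Proof. exact: vjoin_le. Qed.

Lemma vpos_neg x : vpos x - vpos (- x) = x.
Proof.
rewrite /vpos; apply/eqP; rewrite subr_eq addrC vjoinD addNr add0r.
by rewrite vjoinC.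
Qed.

Lemma vabs_pos_neg x : vabs x [<=] vpos x + vpos (- x).
Proof.
by apply: vabs_le;
  [rewrite -[X in X [<=] _]addr0|rewrite -[X in X [<=] _]add0r]; apply: vleD;
  (exact: vle_pos || exact: vpos_ge0).
Qed.

Lemma vmeet_pos_neg x : vmeet (vpos x) (vpos (- x)) = 0.
Proof.
have -> : vmeet (vpos x) (vpos (- x)) = vmeet x 0 + vpos (- x).
  rewrite vmeetD add0r; congr vmeet.
  by apply/esym/eqP; rewrite eq_sym -subr_eq vpos_neg.
by rewrite /vmeet /vpos oppr0 addrC subrr.
Qed.

Lemma vpos_dist x y : vabs (vpos x - vpos y) [<=] vabs (x - y).
Proof.
have h u v : vpos u [<=] vpos v + vabs (u - v).
  apply: vpos_le; last by apply: vadd_ge0; [exact: vpos_ge0|exact: vabs_ge0].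
  apply: vle_trans (vle_dist u v) _; apply: vleD2r; exact: vle_pos.
by apply: vabs_dist => //; rewrite vabs_distC.
Qed.

Lemma vabs_sum (I : Type) (r : seq I) (Q : pred I) (f : I -> V) :
  vabs (\sum_(i <- r | Q i) f i) [<=] \sum_(i <- r | Q i) vabs (f i).
Proof.
elim/big_ind2: _ => // [|a a' b b' ha hb]; first by rewrite vabs_id.
exact: vle_trans (vabsD _ _) (vleD ha hb).
Qed.

Lemma vmeet_dist x y z : vabs (vmeet x z - vmeet y z) [<=] vabs (x - y).
Proof.
have h u v : vmeet u z [<=] vmeet v z + vabs (u - v).
  apply: vle_addr; apply: vle_meet; apply: vle_subl.
    exact: vle_trans (vmeet_lel _ _) (vle_dist _ _).
  apply: vle_trans (vmeet_ler _ _) _; apply: vle_add; exact: vabs_ge0.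
by apply: vabs_dist => //; rewrite vabs_distC.
Qed.

Lemma vmeetDl x y z : 0 [<=] x -> 0 [<=] y -> 0 [<=] z ->
  vmeet (x + y) z [<=] vmeet x z + vmeet y z.
Proof.
move=> x0 y0 z0; apply: vle_addr; apply: vle_meet; apply: vle_subl.
  rewrite [x + vmeet _ _]addrC vmeetD; apply: vle_meet.
    by rewrite addrC; exact: vmeet_lel.
  apply: vle_trans (vmeet_ler _ _) _; exact: vle_add.
apply: vle_trans (vmeet_ler _ _) _.
by apply: vle_add; exact: vmeet_ge0.
Qed.

Lemma vmeet_suml (I : Type) (r : seq I) (Q : pred I) (f : I -> V) z :
  0 [<=] z -> (forall i, Q i -> 0 [<=] f i) ->
  vmeet (\sum_(i <- r | Q i) f i) z [<=] \sum_(i <- r | Q i) vmeet (f i) z.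
Proof.
move=> z0 f0; suff [] : 0 [<=] \sum_(i <- r | Q i) f i /\
  vmeet (\sum_(i <- r | Q i) f i) z [<=] \sum_(i <- r | Q i) vmeet (f i) z by [].
elim/big_ind2: _ => [|a a' b b' [a0 ha] [b0 hb]|i Qi].
- by split => //; exact: vmeet_lel.
- split; first exact: vadd_ge0.
  by apply: vle_trans (vmeetDl _ _ _) (vleD ha hb).
- by split => //; exact: f0.
Qed.

Lemma vdisjointZ a x y : 0 [<=] x -> 0 [<=] y ->
  vmeet (vabs (a *: x)) y [<=] (1 + `|a|) *: vmeet x y.
Proof.
move=> x0 y0; rewrite vabsZ vabs_id // vmeetZ ?addr_ge0 //.
apply: vle_meet2; first by apply: vleZl => //; rewrite lerDr.
by rewrite -{1}[y]scale1r; apply: vleZl => //; rewrite lerDl.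
Qed.

(** For elements below a common bound [e], the sum exceeds [e] by at most the
    pairwise overlaps: this is [y + s = vjoin y s + vmeet y s], iterated. *)
Lemma vsum_le_overlap e (k : nat) (y : nat -> V) : 0 [<=] e ->
  (forall i, (i < k)%N -> 0 [<=] y i) ->
  (forall i, (i < k)%N -> y i [<=] e) ->
  \sum_(i < k) y i [<=]
  e + \sum_(i < k) \sum_(j < i) vmeet (y j) (y i).
Proof.
move=> e0; elim: k => [|k ih] y0 ye; first by rewrite !big_ord0 addr0.
have y0' i : (i < k)%N -> 0 [<=] y i by move=> ik; apply: y0; exact: leqW.
have ym0 i j : (i < k)%N -> (j < k.+1)%N -> 0 [<=] vmeet (y i) (y j).
  by move=> ik jk; apply: vmeet_ge0; [exact: y0'|exact: y0].
rewrite !big_ord_recr /= addrA -vjoin_meet; apply: vleD.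
  apply: vjoin_le.
    apply: ih => // i ik; apply: ye; exact: leqW.
  apply: vle_trans (ye k _) _ => //; apply: vle_add.
  apply: vsum_ge0 => i _; apply: vsum_ge0 => j _.
  by apply: ym0; [exact: ltn_trans (ltn_ord i)|exact/leqW].
by apply: vmeet_suml => [|i _]; [exact: y0|exact/y0'/ltn_ord].
Qed.

End VectorLatticeTheory.

(** * Disjoint systems and atoms *)

(** The domain is part of the data: the limit of norms along a sequence is a
    seminorm on those sequences for which it exists. *)
Record rieszSeminorm (R : realFieldType) (V : vectorLattice R) :=
    RieszSeminorm {
  rs_dom : V -> Prop;
  rs_fun :> V -> R;
  rs_domD : forall x y, rs_dom x -> rs_dom y -> rs_dom (x + y);
  rs_domZ : forall a x, rs_dom x -> rs_dom (a *: x);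
  rs_dom_abs : forall x, rs_dom x -> rs_dom (vabs x);
  rsD : forall x y, rs_dom x -> rs_dom y ->
    rs_fun (x + y) <= rs_fun x + rs_fun y;
  rsZ : forall a x, rs_dom x -> rs_fun (a *: x) = `|a| * rs_fun x;
  rs_le : forall x y, rs_dom x -> rs_dom y -> vle (vabs x) (vabs y) ->
    rs_fun x <= rs_fun y
}.

(** Disjointness is required modulo null elements only, because that is what
    survives subtracting the components of a vector along atoms. *)
Definition disjoint_system (R : realFieldType) (V : vectorLattice R)
    (p : rieszSeminorm V) (k : nat) (x : nat -> V) : Prop :=
  (forall i, (i < k)%N -> [/\ rs_dom p (x i), vle 0 (x i) & 0 < p (x i)]) /\
  (forall i j, (i < k)%N -> (j < k)%N -> i != j -> p (vmeet (x i) (x j)) = 0).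

Section Seminorm.
Local Notation "x [<=] y" := (vle x y) (at level 70, no associativity).
Variables (R : realFieldType) (V : vectorLattice R) (p : rieszSeminorm V).
Implicit Types (x y z v w : V) (a b s t : R).
Local Notation M := (rs_dom p).

Lemma rs_domN x : M x -> M (- x).
Proof. by rewrite -scaleN1r; exact: rs_domZ. Qed.

Lemma rs_domB x y : M x -> M y -> M (x - y).
Proof. by move=> ? /rs_domN; exact: rs_domD. Qed.

Lemma rs_dom0 x : M x -> M 0.
Proof. by move=> /(rs_domZ 0); rewrite scale0r. Qed.

Lemma rs_dom_join x y : M x -> M y -> M (vjoin x y).
Proof.
move=> Mx My; rewrite vjoin_abs; apply/rs_domZ/rs_domD; first exact: rs_domD.
exact/rs_dom_abs/rs_domB.
Qed.

Lemma rs_dom_meet x y : M x -> M y -> M (vmeet x y).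
Proof. by move=> Mx My; apply/rs_domN/rs_dom_join; exact: rs_domN. Qed.

Lemma rs_dom_pos x : M x -> M (vpos x).
Proof. by move=> Mx; apply: rs_dom_join => //; exact: rs_dom0 Mx. Qed.

Lemma rs_dom_sum (I : Type) (r : seq I) (Q : pred I) (f : I -> V) :
  M 0 -> (forall i, Q i -> M (f i)) -> M (\sum_(i <- r | Q i) f i).
Proof. by move=> M0 h; elim/big_ind: _ => //; exact: rs_domD. Qed.

Lemma rs0 : M 0 -> p 0 = 0.
Proof. by move=> M0; rewrite -(scale0r 0) rsZ // normr0 mul0r. Qed.

Lemma rsN x : M x -> p (- x) = p x.
Proof. by move=> Mx; rewrite -scaleN1r rsZ // normrN1 mul1r. Qed.

Lemma rs_ge0 x : M x -> 0 <= p x.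
Proof.
move=> Mx; have := rsD Mx (rs_domN Mx).
by rewrite subrr (rs0 (rs_dom0 Mx)) rsN //; lra.
Qed.

Lemma rs_abs x : M x -> p (vabs x) = p x.
Proof.
move=> Mx; have Ma := rs_dom_abs Mx.
by apply/eqP; rewrite eq_le !rs_le // vabs_abs; exact: vle_refl.
Qed.

Lemma rs_le_pos x y : M x -> M y -> 0 [<=] x -> x [<=] y -> p x <= p y.
Proof.
move=> Mx My x0 xy; apply: rs_le => //; rewrite !vabs_id //.
exact: vle_trans xy.
Qed.

Lemma rs_sum (I : Type) (r : seq I) (Q : pred I) (f : I -> V) :
  M 0 -> (forall i, Q i -> M (f i)) ->
  p (\sum_(i <- r | Q i) f i) <= \sum_(i <- r | Q i) p (f i).
Proof.
move=> M0 h; suff [] : M (\sum_(i <- r | Q i) f i) /\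
  p (\sum_(i <- r | Q i) f i) <= \sum_(i <- r | Q i) p (f i) by [].
elim/big_ind2: _ => [|a a' b b' [Ma ha] [Mb hb]|i Qi].
- by rewrite rs0.
- by split; [exact: rs_domD|rewrite (le_trans (rsD Ma Mb)) // lerD].
- by split => //; exact: h.
Qed.

Lemma rs_dist x y : M x -> M y -> `|p x - p y| <= p (x - y).
Proof.
have h u v : M u -> M v -> p u - p v <= p (u - v).
  move=> Mu Mv; rewrite lerBlDr -{1}(subrK v u); apply: rsD => //.
  exact: rs_domB.
move=> Mx My; rewrite ler_norml h // andbT lerNl opprB.
by rewrite -[x - y]opprB rsN ?h //; exact: rs_domB.
Qed.

Lemma rs_eq0 x y : M x -> M y -> 0 [<=] x -> x [<=] y -> p y = 0 -> p x = 0.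
Proof.
move=> Mx My x0 xy y0; apply/eqP; rewrite eq_le rs_ge0 // andbT -y0.
exact: rs_le_pos.
Qed.

(** A member containing two disjoint pieces can be split, so the members of a
    system of maximal size are atoms. *)
Lemma disjoint_system_split k (x : nat -> V) i u v :
  disjoint_system p k x -> (i < k)%N ->
  M u -> M v -> 0 [<=] u -> 0 [<=] v -> u [<=] x i -> v [<=] x i ->
  0 < p u -> 0 < p v -> p (vmeet u v) = 0 ->
  disjoint_system p k.+1
    (fun j => if j == i then u else if j == k then v else x j).
Proof.
move=> [h1 h2] ik Mu Mv u0 v0 ux vx pu pv puv; split => [j jk|].
  case: eqVneq => // ji; case: eqVneq => // jk'; apply: h1.
  by rewrite ltn_neqAle jk' -ltnS.
have small w j : M w -> 0 [<=] w -> w [<=] x i -> (j < k.+1)%N -> j != k ->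
    j != i -> p (vmeet w (x j)) = 0.
  move=> Mw w0 wx jk jk' ji; have jk2 : (j < k)%N by rewrite ltn_neqAle jk' -ltnS.
  have [Mx _ _] := h1 i ik; have [Mj j0 _] := h1 j jk2.
  apply: (@rs_eq0 _ (vmeet (x i) (x j))).
  - exact: rs_dom_meet.
  - exact: rs_dom_meet.
  - exact: vmeet_ge0.
  - by apply: vle_meet2 => //; exact: vle_refl.
  - by apply: h2 => //; rewrite eq_sym.
move=> j j' jk jk' jj'.
case: (eqVneq j i) => [ji|ji]; case: (eqVneq j' i) => [j'i|j'i].
- by rewrite ji j'i eqxx in jj'.
- by case: eqVneq => // j'k; exact: small.
- by case: eqVneq => // jk2; rewrite vmeetC //; exact: small.
case: (eqVneq j k) => [jk2|jk2]; case: (eqVneq j' k) => [j'k2|j'k2].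
- by rewrite jk2 j'k2 eqxx in jj'.
- exact: small.
- by rewrite vmeetC; exact: small.
- by apply: h2 => //; rewrite ltn_neqAle ?jk2 ?j'k2 -ltnS.
Qed.

Lemma disjoint_system_rcons k (x : nat -> V) w : disjoint_system p k x ->
  M w -> 0 [<=] w -> 0 < p w ->
  (forall j, (j < k)%N -> p (vmeet w (x j)) = 0) ->
  disjoint_system p k.+1 (fun j => if j == k then w else x j).
Proof.
move=> [h1 h2] Mw w0 pw hw.
have lt j : (j < k.+1)%N -> j != k -> (j < k)%N.
  by move=> jk jk'; rewrite ltn_neqAle jk' -ltnS.
split => [j jk|j j' jk jk' jj'].
  by case: eqVneq => // /(lt _ jk); exact: h1.
case: (eqVneq j k) => [jk2|/(lt _ jk) jk2];
  case: (eqVneq j' k) => [j'k2|/(lt _ jk') j'k2].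
- by rewrite jk2 j'k2 eqxx in jj'.
- exact: hw.
- by rewrite vmeetC; exact: hw.
- exact: h2.
Qed.

End Seminorm.

Section Atoms.
Local Notation "x [<=] y" := (vle x y) (at level 70, no associativity).
Variables (R : realType) (V : vectorLattice R) (p : rieszSeminorm V).
Implicit Types (x y z v w : V) (a b s t : R).
Local Notation M := (rs_dom p).

(** At each point [x] is at most [s x - v] or at most [|v| / (s - 1)], so the
    part of [x] that [s x - v] does not reach is small for large [s]. *)
Lemma rs_meet_pos_gt0 x v : M x -> M v -> 0 [<=] x -> 0 < p x ->
  exists2 s, 0 < s & 0 < p (vmeet (vpos (s *: x - v)) x).
Proof.
move=> Mx Mv x0 px; set r : R := 1 + 2 * p v / p x.
have r1 : 1 <= r.
  by rewrite lerDl divr_ge0 ?mulr_ge0 ?rs_ge0 // ltW.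
have r0 : 0 < r by exact: lt_le_trans r1.
exists (1 + r); first by rewrite addr_gt0.
set u := vmeet _ _.
have Mu : M u.
  by apply: rs_dom_meet => //; apply/rs_dom_pos/rs_domB => //; exact: rs_domZ.
have Mw : M (r^-1 *: vabs v) by apply/rs_domZ/rs_dom_abs.
have hx : x [<=] u + r^-1 *: vabs v.
  apply: vle_addr; apply: vle_meet; apply: vle_subl; last first.
    by apply: vle_add; apply: vscale_ge0; [rewrite invr_ge0 ltW|exact: vabs_ge0].
  set w := vpos _.
  have w0 : 0 [<=] w by exact: vpos_ge0.
  have : r *: x [<=] r *: w + vabs v.
    apply: (vle_trans (y := (1 + r) *: x)).
      by apply: vleZl => //; rewrite lerDr.
    rewrite -[X in X [<=] _](subrK v); apply: vleD; last exact: vle_abs.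
    apply: (vle_trans (vle_pos _)); rewrite -[X in X [<=] _]scale1r.
    exact: vleZl.
  have ri : 0 <= r^-1 by rewrite invr_ge0 ltW.
  by move=> /(vleZ ri); rewrite scalerDr !scalerA mulVf ?scale1r // gt_eqF.
have : p x <= p u + r^-1 * p v.
  rewrite -(rs_abs Mv) -[r^-1]ger0_norm ?invr_ge0 ?(ltW r0) //.
  rewrite -rsZ; last exact: rs_dom_abs.
  by apply: le_trans (rsD Mu Mw); apply: rs_le_pos => //; exact: rs_domD.
have : r^-1 * p v < p x.
  rewrite mulrC ltr_pdivrMr // /r mulrDr mulr1 mulrCA divff ?gt_eqF // mulr1.
  by have := rs_ge0 Mv; lra.
lra.
Qed.

(** Maximality forces [x i] to be an atom: for every [s] the parts of [x i]
    reached by [v - s x i] and by its opposite are disjoint, so one of them is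
    null. The crossing value of [s] makes both null. *)
Lemma disjoint_system_coef k (x : nat -> V) i v : disjoint_system p k x ->
  (forall y : nat -> V, ~ disjoint_system p k.+1 y) -> (i < k)%N -> M v ->
  exists s, p (vmeet (vabs (v - s *: x i)) (x i)) = 0.
Proof.
move=> sx maxk ik Mv; have [Mx x0 px] := sx.1 i ik.
have Mvs s : M (v - s *: x i) by apply: rs_domB => //; exact: rs_domZ.
have MP s : M (vmeet (vpos (v - s *: x i)) (x i)).
  by apply: rs_dom_meet => //; exact: rs_dom_pos.
have MN s : M (vmeet (vpos (- (v - s *: x i))) (x i)).
  by apply: rs_dom_meet => //; apply/rs_dom_pos/rs_domN.
pose f s := p (vmeet (vpos (v - s *: x i)) (x i)).
pose g s := p (vmeet (vpos (- (v - s *: x i))) (x i)).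
have f0 s : 0 <= f s by exact: rs_ge0.
have g0 s : 0 <= g s by exact: rs_ge0.
have fg s : f s = 0 \/ g s = 0.
  have [->|fn] := eqVneq (f s) 0; first by left.
  have [->|gn] := eqVneq (g s) 0; first by right.
  exfalso; apply: (maxk _ (disjoint_system_split sx ik (MP s) (MN s) _ _ _ _ _ _ _)).
  - by apply: vmeet_ge0 => //; exact: vpos_ge0.
  - by apply: vmeet_ge0 => //; exact: vpos_ge0.
  - exact: vmeet_ler.
  - exact: vmeet_ler.
  - by rewrite lt_neqAle eq_sym fn f0.
  - by rewrite lt_neqAle eq_sym gn g0.
  - apply: (@rs_eq0 _ _ p _ 0).
    + exact: rs_dom_meet.
    + exact: rs_dom0 Mv.
    + by apply: vmeet_ge0; apply: vmeet_ge0 => //; exact: vpos_ge0.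
    + rewrite -(vmeet_pos_neg (v - s *: x i)).
      by apply: vle_meet2; exact: vmeet_lel.
    + exact: rs0 (rs_dom0 Mv).
have dist u u' : M u -> M u' ->
    `|p (vmeet (vpos u) (x i)) - p (vmeet (vpos u') (x i))| <= p (u - u').
  move=> Mu Mu'; apply: le_trans (rs_dist _ _) _.
  - by apply: rs_dom_meet => //; exact: rs_dom_pos.
  - by apply: rs_dom_meet => //; exact: rs_dom_pos.
  - apply: rs_le.
    + by apply: rs_domB; apply: rs_dom_meet => //; exact: rs_dom_pos.
    + exact: rs_domB.
    + exact: vle_trans (vmeet_dist _ _ _) (vpos_dist _ _).
have lip s t : `|(f s - g s) - (f t - g t)| <= 2 * p (x i) * `|s - t|.
  have hf : `|f s - f t| <= p (x i) * `|s - t|.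
    apply: le_trans (dist _ _ _ _) _ => //.
    rewrite opprD opprK addrACA subrr add0r -scaleNr -scalerDl rsZ // mulrC.
    by rewrite addrC distrC.
  have hg : `|g s - g t| <= p (x i) * `|s - t|.
    apply: le_trans (dist _ _ _ _) _; [exact: rs_domN|exact: rs_domN|].
    by rewrite opprK opprB addrA subrK -scalerBl rsZ // mulrC.
  have -> : (f s - g s) - (f t - g t) = (f s - f t) - (g s - g t) by lra.
  by apply: le_trans (ler_normB _ _) _; lra.
have cont : continuous (fun s => f s - g s).
  move=> s; apply/cvgrPdist_lt => e e0.
  have q0 : 0 < 2 * p (x i) + 1 by lra.
  near=> t; apply: le_lt_trans (lip s t) _.
  have : `|s - t| < e / (2 * p (x i) + 1).
    by near: t; apply: cvgr_dist_lt; [exact: cvg_id|exact: divr_gt0].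
  rewrite ltr_pdivlMr // => h; apply: le_lt_trans h.
  by rewrite mulrC ler_wpM2l // lerDl.
have [b b0 gb] := rs_meet_pos_gt0 Mx Mv x0 px.
have [a a0 fa] := rs_meet_pos_gt0 Mx (rs_domN Mv) x0 px.
have hb : f b - g b <= 0.
  case: (fg b) => [->|]; first by rewrite sub0r oppr_le0.
  by move: gb; rewrite /g opprB => /[swap] ->; rewrite ltxx.
have ha : 0 <= f (- a) - g (- a).
  case: (fg (- a)) => [|->]; last by rewrite subr0.
  rewrite /f scaleNr opprK addrC => h.
  by move: fa; rewrite opprK h ltxx.
have ab : - a <= b by lra.
have [] := @IVT R (fun s => f s - g s) (- a) b 0 ab.
- exact: continuous_subspaceT.
- by rewrite ge_min le_max hb ha orbT.
move=> c _ /eqP; rewrite subr_eq0 => /eqP fgc; exists c.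
have [fc gc] : f c = 0 /\ g c = 0 by case: (fg c) => h; move: fgc; rewrite h.
have MA : M (vmeet (vabs (v - c *: x i)) (x i)).
  by apply: rs_dom_meet => //; exact: rs_dom_abs.
apply: (rs_eq0 MA (rs_domD (MP c) (MN c))).
- by apply: vmeet_ge0 => //; exact: vabs_ge0.
- apply: vle_trans (vmeetDl _ _ _) => //; try exact: vpos_ge0.
  by apply: vle_meet2; [exact: vabs_pos_neg|exact: vle_refl].
- apply/eqP; rewrite eq_le rs_ge0 ?andbT; last exact: rs_domD.
  by apply: le_trans (rsD (MP c) (MN c)) _; rewrite -/(f c) -/(g c) fc gc addr0.
Unshelve. all: by end_near.
Qed.

(** A bound on the size of disjoint systems bounds the dimension modulo null
    elements: a system of maximal size consists of atoms that span. *)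
Theorem bounded_disjoint_systems_span (K : nat) (z : V) : M z ->
  (forall k (x : nat -> V), disjoint_system p k x -> (k <= K)%N) ->
  exists k (x : nat -> V), (forall i, (i < k)%N -> M (x i)) /\
    forall v, M v -> exists s : nat -> R,
      p (v - \sum_(i < k) s i *: x i) = 0.
Proof.
move=> /rs_dom0 M0 bnd.
have [k [x [sx maxk]]] : exists k (x : nat -> V), disjoint_system p k x /\
    forall y : nat -> V, ~ disjoint_system p k.+1 y.
  apply: contrapT => nmax.
  have [x /bnd] : exists x : nat -> V, disjoint_system p K.+1 x; last by rewrite ltnn.
  elim: K.+1 => [|k [x sx]]; first by exists (fun=> 0).
  apply: contrapT => nx; apply: nmax; exists k, x; split => // y sy.
  by apply: nx; exists y.
have Mx i : (i < k)%N -> M (x i) by move=> /sx.1[].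
exists k, x; split => // v Mv.
have /choice[s hs] : forall i, exists s,
    (i < k)%N -> p (vmeet (vabs (v - s *: x i)) (x i)) = 0.
  move=> i; have [ik|ik] := boolP (i < k)%N; last by exists 0.
  by have [s] := disjoint_system_coef sx maxk ik Mv; exists s.
exists s; set w := v - _.
have Msum (Q : pred 'I_k) : M (\sum_(i < k | Q i) s i *: x i).
  by apply: rs_dom_sum => // i _; apply/rs_domZ/Mx.
have Mw : M w by apply: rs_domB.
apply/eqP; rewrite eq_le rs_ge0 // andbT leNgt; apply/negP => pw.
apply: (maxk _ (disjoint_system_rcons sx (rs_dom_abs Mw) (vabs_ge0 _) _ _)).
  by rewrite rs_abs.
move=> i ik; have [_ x0 _] := sx.1 i ik.
have M1 : M (vmeet (vabs (v - s i *: x i)) (x i)).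
  by apply/rs_dom_meet/Mx => //; apply/rs_dom_abs/rs_domB/rs_domZ/Mx.
have M2 j : (j < k)%N -> M (vmeet (vabs (s j *: x j)) (x i)).
  by move=> jk; apply/rs_dom_meet/Mx => //; apply/rs_dom_abs/rs_domZ/Mx.
have hle : vmeet (vabs w) (x i) [<=] vmeet (vabs (v - s i *: x i)) (x i) +
    \sum_(j < k | j != Ordinal ik) vmeet (vabs (s j *: x j)) (x i).
  apply: (@vle_trans _ _ (vmeet (vabs (v - s i *: x i) +
      \sum_(j < k | j != Ordinal ik) vabs (s j *: x j)) (x i))).
    apply: vle_meet2; last exact: vle_refl.
    rewrite /w (bigD1 (Ordinal ik)) //= opprD addrA.
    apply: vle_trans (vabsD _ _) _; apply: vleD; first exact: vle_refl.
    by rewrite vabsN; exact: vabs_sum.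
  apply: vle_trans (vmeetDl _ _ _) _ => //.
  - exact: vabs_ge0.
  - by apply: vsum_ge0 => j _; exact: vabs_ge0.
  - apply: vleD; first exact: vle_refl.
    by apply: vmeet_suml => // j _; exact: vabs_ge0.
have M3 : M (\sum_(j < k | j != Ordinal ik) vmeet (vabs (s j *: x j)) (x i)).
  by apply: rs_dom_sum => // j _; exact: M2.
apply: (rs_eq0 _ (rs_domD M1 M3) _ hle).
- by apply/rs_dom_meet/Mx => //; exact: rs_dom_abs.
- by apply: vmeet_ge0 => //; exact: vabs_ge0.
apply/eqP; rewrite eq_le rs_ge0 ?andbT; last exact: rs_domD.
apply: le_trans (rsD M1 M3) _; rewrite hs // add0r.
apply: (@le_trans _ _ (\sum_(j < k | j != Ordinal ik)
    p (vmeet (vabs (s j *: x j)) (x i)))).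
  by apply: rs_sum => // j _; exact: M2.
rewrite big1 // => j ji; have [Mj xj0 _] := sx.1 j (ltn_ord j).
have Mm := rs_dom_meet Mj (Mx _ ik).
apply: (rs_eq0 (M2 _ _) (rs_domZ (1 + `|s j|) Mm)) => //.
- by apply: vmeet_ge0 => //; exact: vabs_ge0.
- exact: vdisjointZ.
- by rewrite rsZ // sx.2 ?mulr0.
Qed.

End Atoms.

(** * Finite-dimensional subspaces *)

Section FiniteDimension.
Variables (K : fieldType) (V : lmodType K).
Implicit Types (b : nat -> V) (c : nat -> K) (G : V -> Prop).

Definition lincomb b r c : V := \sum_(i < r) c i *: b i.

Definition free_family b r : Prop :=
  forall c, lincomb b r c = 0 -> forall i, (i < r)%N -> c i = 0.

Definition dependent_family b r : Prop :=
  exists2 c, lincomb b r c = 0 & exists2 i, (i < r)%N & c i != 0.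

Lemma lincombZ b r a c : lincomb b r (fun i => a * c i) = a *: lincomb b r c.
Proof. by rewrite scaler_sumr; apply: eq_bigr => i _; rewrite scalerA. Qed.

Lemma free_familyP b r : free_family b r <-> ~ dependent_family b r.
Proof.
split=> [fb [c c0 [i ir]]|dep c c0 i ir]; first by rewrite (fb c) ?eqxx.
by apply/eqP/negP => /negP ci; apply: dep; exists c => //; exists i.
Qed.

Lemma wide_relation k (s : nat -> 'I_k -> K) :
  exists2 a : nat -> K, (exists2 i, (i < k.+1)%N & a i != 0) &
  forall j, \sum_(i < k.+1) a i * s i j = 0.
Proof.
pose S : 'M[K]_(k.+1, k) := \matrix_(i, j) s i j.
have : kermx S != 0.
  rewrite kermx_eq0 /row_free neq_ltn (leq_ltn_trans (rank_leq_col S)) //.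
move=> /matrix0Pn[i [j kij]]; exists (fun m => kermx S i (inord m)).
  by exists j => //; rewrite inord_val.
move=> l.
have : (kermx S *m S) i l = 0 by rewrite mulmx_ker mxE.
rewrite mxE => e; rewrite -[RHS]e; apply: eq_bigr => m _.
by rewrite [S _ _]mxE inord_val.
Qed.

(** A set all of whose families of a given size are dependent has a basis:
    a free family of maximal size. *)
Lemma exists_basis G (k : nat) :
  (forall b, (forall i, (i < k)%N -> G (b i)) -> dependent_family b k) ->
  exists r b, [/\ forall i, (i < r)%N -> G (b i), free_family b r &
    forall x, G x -> exists c, x = lincomb b r c].
Proof.
move=> dep; pose free_in b r := (forall i, (i < r)%N -> G (b i)) /\ free_family b r.
have [r [b [[Gb fb] maxr]]] : exists r b, free_in b r /\
    forall b', ~ free_in b' r.+1.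
  apply: contrapT => nmax.
  have [b [/dep db /free_familyP]] : exists b, free_in b k; last by apply.
  elim: k {dep} => [|k [b fb]]; first by exists (fun=> 0).
  apply: contrapT => nb; apply: nmax; exists k, b; split => // b' fb'.
  by apply: nb; exists b'.
exists r, b; split => // x Gx.
pose b' j := if j == r then x else b j.
have e c : lincomb b' r.+1 c = lincomb b r c + c r *: x.
  rewrite /lincomb big_ord_recr /b' /= eqxx; congr (_ + _).
  by apply: eq_bigr => i _; rewrite ltn_eqF.
have : dependent_family b' r.+1.
  apply: contrapT => /free_familyP fb'; apply: (maxr b'); split => // i.
  by rewrite /b'; case: eqVneq => // ir ir1; apply: Gb; rewrite ltn_neqAle ir.
move=> [c /[!e] c0 [i ir ci]].
have cr : c r != 0.
  apply: contra_neq ci => cr; move: ir; rewrite ltnS leq_eqVlt => /orP[/eqP -> //|].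
  by apply: fb; rewrite -c0 cr scale0r addr0.
exists (fun j => - (c r)^-1 * c j); rewrite lincombZ.
move/eqP: c0; rewrite addr_eq0 => /eqP ->.
by rewrite scalerN scaleNr opprK scalerA mulVf // scale1r.
Qed.

Lemma span_dependent k (g : 'I_k -> V) b :
  (forall i, (i < k.+1)%N ->
    exists c : 'I_k -> K, b i = \sum_(l < k) c l *: g l) ->
  dependent_family b k.+1.
Proof.
move=> h; have /choice[s hs] : forall i, exists c : 'I_k -> K,
    (i < k.+1)%N -> b i = \sum_(l < k) c l *: g l.
  move=> i; have [ik|ik] := boolP (i < k.+1)%N; last by exists (fun=> 0).
  by have [c] := h i ik; exists c.
have [a a0 ha] := wide_relation s.
exists a => //; rewrite /lincomb.
under eq_bigr => i _ do rewrite hs // scaler_sumr.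
rewrite exchange_big big1 //= => j _.
under eq_bigr => i _ do rewrite scalerA.
by rewrite -scaler_suml ha // scale0r.
Qed.

End FiniteDimension.

Section FiniteDimensionNormed.
Variables (R : realType) (V : normedModType R).
Implicit Types (b : nat -> V) (c : nat -> R).

Lemma rV_lincomb_continuous b r :
  continuous (fun u : 'rV[R]_r => \sum_(i < r) u 0 i *: b i : V).
Proof.
move=> u; apply: cvg_big => [| |i _]; [exact: add_continuous|exact: nbhs_filter|].
apply: (@cvgZr_tmp R V _ (nbhs u) _ (fun v : 'rV[R]_r => v 0 i) (u 0 i) (b i)).
exact: (@coord_continuous R 1 r 0 i u).
Qed.

(** All norms on a finite-dimensional space are equivalent: the norm of a
    combination of free vectors has a positive minimum on the unit sphere of
    the coefficients. *)
Lemma free_family_coef_bound b r : free_family b r ->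
  exists2 C : R, 0 < C &
  forall c i, (i < r)%N -> `|c i| <= C * `|lincomb b r c|.
Proof.
case: r => [|r] fb; first by exists 1.
pose f (u : 'rV[R]_r.+1) := `|\sum_(i < r.+1) u 0 i *: b i|.
have fE c : f (\row_i c i) = `|lincomb b r.+1 c|.
  by rewrite /f; under eq_bigr do rewrite mxE.
have fc : continuous f.
  move=> u; have h := @rV_lincomb_continuous b r.+1 u.
  exact: (@cvg_norm _ _ _ (nbhs u) _ _ _ h).
pose A := [set u : 'rV[R]_r.+1 | `|u| = 1].
have A0 : A !=set0.
  pose w : 'rV[R]_r.+1 := const_mx 1.
  have w0 : w != 0.
    by apply/matrix0Pn; exists 0, 0; rewrite mxE oner_eq0.
  exists (`|w|^-1 *: w); rewrite /A /= normrZ normfV normr_id mulVf //.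
  by rewrite normr_eq0.
have Ac : compact A.
  apply: bounded_closed_compact.
    exists 1; split => // M M1 u /= ->; exact: ltW.
  apply: (@closed_comp _ _ (Num.norm : 'rV[R]_r.+1 -> R) [set 1]).
    by move=> *; exact: norm_continuous.
  exact: closed_eq.
have [u /[!inE] uA umin] := compact_EVT_min A0 Ac (continuous_subspaceT fc).
have fu0 : 0 < f u.
  rewrite lt_neqAle normr_ge0 andbT eq_sym normr_eq0; apply/negP => /eqP u0.
  have /eqP : `|u| = 1 by [].
  suff -> : u = 0 by rewrite normr0 eq_sym oner_eq0.
  apply/rowP => i; rewrite mxE.
  have := fb (fun i => u 0 (inord i)) _ i (ltn_ord i); rewrite inord_val; apply.
  by rewrite -u0; apply: eq_bigr => j _; rewrite inord_val.
exists (f u)^-1 => [|c i ir]; first by rewrite invr_gt0.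
pose v : 'rV[R]_r.+1 := \row_i c i.
have vi : `|c i| <= `|v|.
  have -> : c i = v 0 (Ordinal ir) by rewrite mxE.
  rewrite [`|v|]mx_normrE.
  exact: (le_bigmax _ (fun ij => `|v ij.1 ij.2|) (0, Ordinal ir)).
apply: le_trans vi _.
have [->|v0] := eqVneq v 0; first by rewrite normr0 mulr_ge0 // invr_ge0 ltW.
have nv : 0 < `|v| by rewrite normr_gt0.
have : `|v|^-1 *: v \in A.
  by rewrite inE /A /= normrZ normfV normr_id mulVf // gt_eqF.
move=> /umin; have -> : f (`|v|^-1 *: v) = `|v|^-1 * `|lincomb b r.+1 c|.
  rewrite -fE -/v /f; under eq_bigr do rewrite mxE -scalerA.
  by rewrite -scaler_sumr normrZ normfV normr_id.
by rewrite !ler_pdivlMl // mulrC.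
Qed.

(** This provides cluster points of bounded sequences in the span of [b]. *)
Lemma free_family_compact b r (B : R) : free_family b r ->
  exists2 A : set V, compact A &
  forall c, `|lincomb b r c| <= B -> A (lincomb b r c).
Proof.
move=> fb; have [C C0 hC] := free_family_coef_bound fb.
pose D := [set u : 'rV[R]_r | forall i, `[(- (C * B)), (C * B)]%classic (u 0 i)].
exists [set \sum_(i < r) u 0 i *: b i | u in D].
  apply: continuous_compact.
    by apply: continuous_subspaceT; exact: rV_lincomb_continuous.
  apply: (@rV_compact R r (fun=> `[(- (C * B)), (C * B)]%classic)) => i.
  exact: segment_compact.
move=> c cB; exists (\row_i c i); last first.
  by rewrite /lincomb; under eq_bigr do rewrite mxE.
move=> i; rewrite mxE /= in_itv /= -ler_norml; apply: le_trans (hC _ _ _) _ => //.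
by rewrite ler_wpM2l // ltW.
Qed.

End FiniteDimensionNormed.

(** * Banach lattices and their sequences as vector lattices *)

Section BanachVectorLattice.
Variables (R : realType) (E : banachLattice R).

Definition banach_vectorLattice : vectorLattice R.
Proof.
refine (@VectorLattice R E (fun x y => bl_le x y) (@bl_join R E)
  _ _ _ _ _ _ _ _).
- exact: bl_le_refl.
- by move=> x y xy yx; apply: bl_le_anti; rewrite xy yx.
- by move=> y x z; exact: bl_le_trans.
- by move=> x y; apply: (bl_joinP x y).1; left.
- by move=> x y; apply: (bl_joinP x y).1; right.
- by move=> x y z xz yz; apply: (bl_joinP x y).2 => _ [] ->.
- by move=> z x y; exact: bl_leD2r.
- exact: bl_scale_ge0.
Defined.

Definition sequence_vectorLattice : vectorLattice R.
Proof.
refine (@VectorLattice R (nat -> E) (fun x y => forall n, bl_le (x n) (y n))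
  (fun x y n => bl_join (x n) (y n)) _ _ _ _ _ _ _ _).
- by move=> x n; exact: bl_le_refl.
- by move=> x y xy yx; apply/funext => n; apply: bl_le_anti; rewrite xy yx.
- by move=> y x z xy yz n; exact: bl_le_trans (xy n) (yz n).
- by move=> x y n; apply: (bl_joinP _ _).1; left.
- by move=> x y n; apply: (bl_joinP _ _).1; right.
- by move=> x y z xz yz n; apply: (bl_joinP _ _).2 => _ [] ->.
- by move=> z x y xy n; exact: bl_leD2r.
- by move=> a x a0 x0 n; apply: bl_scale_ge0 => //; exact: x0.
Defined.

End BanachVectorLattice.

Section BanachLatticeNorm.
Local Notation "x [<=] y" := (vle x y) (at level 70, no associativity).
Variables (R : realType) (E : banachLattice R).
Local Notation V := (banach_vectorLattice E).
Implicit Types x y : V.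

Lemma bl_norm_vle x y : vabs x [<=] vabs y -> `|x : E| <= `|y : E|.
Proof. exact: bl_norm_le. Qed.

Lemma bl_norm_abs x : `|vabs x : E| = `|x : E|.
Proof.
by apply/eqP; rewrite eq_le !bl_norm_vle // vabs_abs; exact: vle_refl.
Qed.

Lemma bl_norm_le_pos x y : 0 [<=] x -> x [<=] y -> `|x : E| <= `|y : E|.
Proof.
move=> x0 xy; apply: bl_norm_vle; rewrite !vabs_id //; exact: vle_trans xy.
Qed.

End BanachLatticeNorm.

(** * Uniformly ergodic positive isometries of a real Banach lattice *)

Section UniformlyErgodic.
Variables (R : realType) (E : banachLattice R) (T P : {linear E -> E}).
Implicit Types (x y z : E) (k m n : nat).

Local Notation V := (banach_vectorLattice E).
Local Notation "x [<=] y" := (@vle R V x y) (at level 70, no associativity).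
Local Notation absE := (@vabs R V : E -> E).
Local Notation meetE := (@vmeet R V : E -> E -> E).

Definition average n x : E := n%:R^-1 *: \sum_(1 <= k < n.+1) iter k T x.

Hypothesis T_pos : forall x, 0 [<=] x -> 0 [<=] T x.
Hypothesis T_iso : forall x, `|T x| = `|x|.
Hypothesis T_erg : forall eps : R, 0 < eps -> exists N, forall n, (N <= n)%N ->
  forall x, `|average n x - P x| <= eps * `|x|.

Lemma iterTB k x y : iter k T (x - y) = iter k T x - iter k T y.
Proof. by elim: k => //= k ->; rewrite linearB. Qed.

Lemma iterTD k x y : iter k T (x + y) = iter k T x + iter k T y.
Proof. by elim: k => //= k ->; rewrite linearD. Qed.

Lemma iterTZ k (a : R) x : iter k T (a *: x) = a *: iter k T x.
Proof. by elim: k => //= k ->; rewrite linearZ. Qed.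

Lemma iterT0 k : iter k T 0 = 0.
Proof. by elim: k => //= k ->; rewrite linear0. Qed.

Lemma iterT_sum k (I : Type) (r : seq I) (Q : pred I) (f : I -> E) :
  iter k T (\sum_(i <- r | Q i) f i) = \sum_(i <- r | Q i) iter k T (f i).
Proof.
elim/big_ind2: _ => // [|x x' y y' <- <-]; first exact: iterT0.
exact: iterTD.
Qed.

Lemma iterT_iso k x : `|iter k T x| = `|x|.
Proof. by elim: k => //= k <-; rewrite T_iso. Qed.

Lemma iterT_pos k x : 0 [<=] x -> 0 [<=] iter k T x.
Proof. by move=> x0; elim: k => //= k; exact: T_pos. Qed.

Lemma T_le x y : x [<=] y -> T x [<=] T y.
Proof.
move=> /vsub_ge0 xy; apply: vle_of_sub.
by have := T_pos xy; rewrite linearB.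
Qed.

Lemma iterT_le k x y : x [<=] y -> iter k T x [<=] iter k T y.
Proof. by move=> xy; elim: k => //= k; exact: T_le. Qed.

Lemma iterT_abs k x : absE (iter k T x) [<=] iter k T (absE x).
Proof.
apply: vabs_le; first by apply: iterT_le; exact: vle_abs.
have -> : - iter k T x = iter k T (- x) by rewrite -[- x]sub0r iterTB iterT0 sub0r.
by apply: iterT_le; exact: vleN_abs.
Qed.

Lemma average_norm n x : `|average n x| <= `|x|.
Proof.
case: n => [|n]; first by rewrite /average big_geq // scaler0 normr0.
rewrite /average normrZ ger0_norm ?invr_ge0 // ler_pdivrMl ?ltr0n //.
apply: le_trans (ler_norm_sum _ _ _) _.
under eq_bigr do rewrite iterT_iso.
by rewrite sumr_const_nat subSS subn0 mulr_natl.
Qed.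

Lemma average_T n x : average n (T x) = T (average n x).
Proof.
rewrite /average linearZ linear_sum; congr (_ *: _); apply: eq_bigr => k _.
by rewrite -iterSr.
Qed.

Lemma average_drift n x : (0 < n)%N ->
  `|T (average n x) - average n x| <= 2 / n%:R * `|x|.
Proof.
move=> n0; have nR : 0 < n%:R^-1 :> R by rewrite invr_gt0 ltr0n.
rewrite /average linearZ -scalerBr normrZ gtr0_norm // [2 / _]mulrC -mulrA.
rewrite ler_pM2l // linear_sum -sumrB telescope_sumr //.
by rewrite (le_trans (ler_normB _ _)) // !iterT_iso -mulr2n mulr_natl.
Qed.

Lemma average_approx (eps : R) : 0 < eps -> exists2 n, (0 < n)%N &
  forall x, `|average n x - P x| <= eps * `|x| /\
            `|T (average n x) - average n x| <= eps * `|x|.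
Proof.
move=> e0; have [N hN] := T_erg e0.
pose m := (Num.bound (2 / eps)).+1.
exists (maxn N m); first by rewrite leq_max orbT.
move=> x; split; first by apply: hN; exact: leq_maxl.
apply: le_trans (average_drift _ _) _; first by rewrite leq_max orbT.
apply: ler_wpM2r => //.
rewrite ler_pdivrMr ?ltr0n ?leq_max ?orbT // mulrC -ler_pdivrMr //.
apply: le_trans (ltW (archi_boundP _)) _; first by rewrite divr_ge0 // ltW.
by rewrite ler_nat (leq_trans _ (leq_maxr _ _)).
Qed.

Lemma norm_small_eq0 (C : R) x :
  (forall eps, 0 < eps -> `|x| <= eps * C) -> x = 0.
Proof.
move=> h; apply/eqP; rewrite -normr_eq0 eq_le normr_ge0 andbT.
have C0 : 0 <= C by have := h 1 ltr01; rewrite mul1r; exact: le_trans.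
apply/ler_addgt0Pr => e e0; rewrite add0r.
have C1 : 0 < C + 1 by lra.
apply: le_trans (h (e / (C + 1)) _) _; first exact: divr_gt0.
by rewrite mulrAC ler_pdivrMr // ler_pM2l // lerDl.
Qed.

Lemma P_norm x : `|P x| <= `|x|.
Proof.
apply/ler_addgt0Pr => e e0; have x1 : 0 < `|x| + 1 by rewrite ltr_wpDl.
have [n _ /(_ x)[h _]] := average_approx (divr_gt0 e0 x1).
have : e / (`|x| + 1) * `|x| <= e.
  by rewrite mulrAC ler_pdivrMr // ler_pM2l // lerDl.
have := average_norm n x.
have -> : P x = average n x - (average n x - P x) by rewrite opprB addrC subrK.
by move=> h1 h2; apply: le_trans (ler_normB _ _) _; lra.
Qed.

Lemma TP x : T (P x) = P x.
Proof.
apply/eqP; rewrite -subr_eq0; apply/eqP; apply: (@norm_small_eq0 (3 * `|x|)).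
move=> e e0; have [n _ /(_ x)[h1 h2]] := average_approx e0.
have -> : T (P x) - P x = - T (average n x - P x) +
    ((T (average n x) - average n x) + (average n x - P x)).
  by rewrite linearB opprB addrA subrKA addrA subrK.
apply: le_trans (ler_normD _ _) _; rewrite normrN T_iso.
have := ler_normD (T (average n x) - average n x) (average n x - P x).
lra.
Qed.

Lemma PT x : P (T x) = P x.
Proof.
apply/eqP; rewrite -subr_eq0; apply/eqP; apply: (@norm_small_eq0 (3 * `|x|)).
move=> e e0; have [n _ h] := average_approx e0.
have [h1 h2] := h x; have [h3 _] := h (T x); rewrite average_T T_iso in h3.
have -> : P (T x) - P x = - (T (average n x) - P (T x)) +
    ((T (average n x) - average n x) + (average n x - P x)).
  by rewrite opprB addrA subrKA addrA subrK.
apply: le_trans (ler_normD _ _) _; rewrite normrN.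
have := ler_normD (T (average n x) - average n x) (average n x - P x).
lra.
Qed.

Lemma iterTP k x : iter k T (P x) = P x.
Proof. by elim: k => //= k ->; exact: TP. Qed.

Lemma P_iterT k x : P (iter k T x) = P x.
Proof. by elim: k => //= k <-; exact: PT. Qed.

Lemma P_fixed x : T x = x -> P x = x.
Proof.
move=> Tx; apply/eqP; rewrite -subr_eq0; apply/eqP.
apply: (@norm_small_eq0 `|x|) => e e0.
have [n n0 /(_ x)[h _]] := average_approx e0; rewrite distrC in h.
move: h; suff -> : average n x = x by rewrite distrC.
rewrite /average (eq_bigr (fun=> x)) => [|k _].
  rewrite sumr_const_nat subn1 /= -(scaler_nat n x) scalerA mulVf ?scale1r //.
  by rewrite pnatr_eq0 -lt0n.
by elim: k => //= k ->.
Qed.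

Lemma PP x : P (P x) = P x.
Proof. exact/P_fixed/TP. Qed.

(** The negative part of [x] is no larger than the distance from [x] to any
    positive vector. *)
Lemma pos_closed x :
  (forall eps : R, 0 < eps -> exists2 y, 0 [<=] y & `|y - x| <= eps) ->
  0 [<=] x.
Proof.
move=> h; suff x0 : @vpos R V (- x) = 0.
  by rewrite -[x](@vpos_neg R V) x0 subr0; exact: vpos_ge0.
apply: (@norm_small_eq0 1) => e /h[y y0 yx]; rewrite mulr1; apply: le_trans yx.
rewrite -[leRHS](@bl_norm_abs R E).
apply: bl_norm_le_pos; first exact: vpos_ge0.
apply: vpos_le; last exact: vabs_ge0.
apply: vle_trans (vle_abs _); rewrite addrC; exact: vle_add.
Qed.

Lemma P_pos x : 0 [<=] x -> 0 [<=] P x.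
Proof.
move=> x0; apply: pos_closed => e e0.
have x1 : 0 < `|x| + 1 by rewrite ltr_wpDl.
have [n n0 /(_ x)[h _]] := average_approx (divr_gt0 e0 x1).
exists (average n x).
  apply: vscale_ge0; first by rewrite invr_ge0.
  by apply: vsum_ge0 => k _; exact: iterT_pos.
by apply: le_trans h _; rewrite mulrAC ler_pdivrMr // ler_pM2l // lerDl.
Qed.

Lemma P_le x y : x [<=] y -> P x [<=] P y.
Proof.
move=> /vsub_ge0 xy; apply: vle_of_sub.
by have := P_pos xy; rewrite linearB.
Qed.

(** ** The limit projection is bounded below on the positive cone *)

Definition orbit_sum m x : E := \sum_(i < m) iter i T x.

Lemma orbit_sumD m x y : orbit_sum m (x + y) = orbit_sum m x + orbit_sum m y.
Proof. by rewrite -big_split; apply: eq_bigr => i _; rewrite iterTD. Qed.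

Lemma P_orbit_sum m x : P x = 0 -> P (orbit_sum m x) = 0.
Proof.
by move=> x0; rewrite linear_sum big1 // => i _; rewrite P_iterT.
Qed.

Lemma orbit_sum_add m k x :
  orbit_sum (m + k) x = orbit_sum m x + iter m T (orbit_sum k x).
Proof.
rewrite /orbit_sum big_split_ord iterT_sum; congr (_ + _).
by apply: eq_bigr => i _; rewrite -iterD.
Qed.

Lemma orbit_sum_norm m x : `|orbit_sum m x| <= m%:R * `|x|.
Proof.
apply: le_trans (ler_norm_sum _ _ _) _.
by under eq_bigr do rewrite iterT_iso; rewrite sumr_const card_ord mulr_natl.
Qed.

(** On the kernel of [P] the averages of a fixed length contract by one half,
    while a partial sum differs from its own average by boundary terms. *)
Lemma orbit_sum_bounded : exists2 C : R, 0 < C &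
  forall m x, P x = 0 -> `|orbit_sum m x| <= C * `|x|.
Proof.
have h2 : 0 < 2^-1 :> R by rewrite invr_gt0.
have [n n0 hn] := average_approx h2.
exists (4 * n%:R) => [|m x Px]; first by rewrite mulr_gt0 ?ltr0n.
set z := orbit_sum m x.
have Pz : P z = 0 by exact: P_orbit_sum.
have h1 : `|average n z| <= 2^-1 * `|z|.
  by have [h _] := hn z; rewrite Pz subr0 in h.
have h3 : `|z - average n z| <= 2 * n%:R * `|x|.
  have nR : (n%:R != 0 :> R) by rewrite pnatr_eq0 -lt0n.
  have -> : z - average n z = n%:R^-1 *: \sum_(1 <= k < n.+1) (z - iter k T z).
    rewrite sumrB scalerBr; congr (_ - _).
    by rewrite sumr_const_nat subn1 /= -(scaler_nat n z) scalerA mulVf ?scale1r.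
  rewrite normrZ ger0_norm ?invr_ge0 // ler_pdivrMl ?ltr0n //.
  apply: le_trans (ler_norm_sum _ _ _) _.
  have -> : n%:R * (2 * n%:R * `|x|) = \sum_(1 <= k < n.+1) (2 * n%:R * `|x|).
    by rewrite sumr_const_nat subn1 /= mulr_natl.
  apply: ler_sum_nat => k /andP[_ kn].
  have -> : z - iter k T z = orbit_sum k x - iter m T (orbit_sum k x).
    apply/eqP; rewrite subr_eq addrAC eq_sym subr_eq -!orbit_sum_add.
    by rewrite addnC.
  apply: le_trans (ler_normB _ _) _; rewrite iterT_iso.
  have : `|orbit_sum k x| <= n%:R * `|x|.
    apply: le_trans (orbit_sum_norm _ _) _.
    by rewrite ler_wpM2r // ler_nat -ltnS.
  lra.
have := ler_normD (z - average n z) (average n z); rewrite subrK.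
lra.
Qed.

(** If [P x] were small, the positive terms [T^i (T^j x)] of the twice iterated
    partial sum, [m] of which equal [T^(m-1) x], could not stay bounded. *)
Lemma P_lower_bound : exists2 d : R, 0 < d &
  forall x, 0 [<=] x -> d * `|x| <= `|P x|.
Proof.
have [C C0 hC] := orbit_sum_bounded.
have [m m0' mC] : exists2 m, (0 < m)%N & 2 * C ^+ 2 + 1 <= m%:R.
  exists (Num.bound (2 * C ^+ 2)).+1 => //.
  rewrite -[X in _ <= X]natr1 lerD2r; apply/ltW/archi_boundP.
  by rewrite mulr_ge0 // exprn_ge0 // ltW.
have m0 : 0 < m%:R :> R by rewrite ltr0n.
exists (m%:R ^- 2) => [|x x0]; first by rewrite invr_gt0 exprn_gt0.
have h1 : m%:R * `|x| <= `|orbit_sum m (orbit_sum m x)|.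
  have -> : m%:R * `|x| = `|\sum_(i < m) iter m.-1 T x|.
    by rewrite sumr_const card_ord normrMn iterT_iso mulr_natl.
  apply: bl_norm_le_pos; first by apply: vsum_ge0 => i _; exact: iterT_pos.
  apply: vle_sum => i _; rewrite /orbit_sum iterT_sum.
  (* keep the term [T^i (T^j x)] with [i + j = m - 1] *)
  rewrite (bigD1 (rev_ord i)) //= -iterD addnBA // -addn1 subnDl subn1.
  by apply: (@vle_add R V); apply: vsum_ge0 => j _; do 2!apply: iterT_pos.
have SP k : orbit_sum k (P x) = k%:R *: P x.
  rewrite /orbit_sum (eq_bigr (fun=> P x)) => [|i _]; last exact: iterTP.
  by rewrite sumr_const card_ord scaler_nat.
have SZ k (a : R) z : orbit_sum k (a *: z) = a *: orbit_sum k z.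
  by rewrite /orbit_sum scaler_sumr; apply: eq_bigr => i _; rewrite iterTZ.
have Py : P (x - P x) = 0 by rewrite linearB PP subrr.
have h2 : `|orbit_sum m (orbit_sum m (x - P x))| <= 2 * C ^+ 2 * `|x|.
  apply: le_trans (hC _ _ (P_orbit_sum _ Py)) _.
  apply: (@le_trans _ _ (C * (C * `|x - P x|))).
    by rewrite ler_pM2l //; exact: hC.
  have -> : 2 * C ^+ 2 * `|x| = C * (C * (2 * `|x|)) by ring.
  rewrite !ler_pM2l //.
  by apply: le_trans (ler_normB _ _) _; have := P_norm x; lra.
have h3 : m%:R * `|x| <= m%:R ^+ 2 * `|P x| + 2 * C ^+ 2 * `|x|.
  apply: le_trans h1 _; rewrite -{1}(subrK (P x) x) addrC orbit_sumD orbit_sumD SP SZ SP.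
  apply: le_trans (ler_normD _ _) _; apply: lerD h2.
  by rewrite scalerA normrZ ger0_norm ?expr2 ?mulr_ge0.
rewrite ler_pdivrMl ?exprn_gt0 //.
have := ler_wpM2r (normr_ge0 x) mC; lra.
Qed.

(** ** Domination by a fixed vector *)

Hypothesis fixed_findim : exists K, forall b : nat -> E,
  (forall i, (i < K)%N -> T (b i) = b i) -> dependent_family b K.

Lemma fixed_basis : exists r (b : nat -> E), free_family b r /\
  forall x, T x = x -> exists c, x = lincomb b r c.
Proof.
have [K hK] := fixed_findim.
have [r [b [_ fb hb]]] := exists_basis (G := fun x => T x = x) hK.
by exists r, b.
Qed.

(** The coordinates of [P x] in a basis of the fixed space are bounded on the
    unit ball, so [P x] lies below a multiple of the sum of the moduli of the
    basis vectors; applying [P] turns that bound into a fixed vector. *)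
Lemma dominating_fixed_vector : exists e : E,
  [/\ 0 [<=] e, T e = e & forall x, `|x| <= 1 -> P x [<=] e].
Proof.
have [r [b [fb hb]]] := fixed_basis.
have [C C0 hC] := free_family_coef_bound fb.
pose w : E := C *: \sum_(i < r) absE (b i).
have w0 : 0 [<=] w.
  by apply: vscale_ge0; [exact: ltW|apply: vsum_ge0 => i _; exact: vabs_ge0].
exists (P w); split; [exact: P_pos|exact: TP|].
move=> x x1; rewrite -PP; apply: P_le.
have [c hc] := hb _ (TP x); rewrite hc.
apply: vle_trans (vle_abs _) _; apply: vle_trans (vabs_sum _ _ _) _.
rewrite /w (scaler_sumr (V := E)); apply: vle_sum => i _; rewrite vabsZ.
apply: vleZl; last exact: vabs_ge0.
apply: le_trans (hC c i (ltn_ord i)) _; rewrite -hc ger_pMr //.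
exact: le_trans (P_norm x) x1.
Qed.

(** An average of [x] is close to [P x], which lies below [e]; so a fixed part
    of the norm of [x] survives in the pieces of its orbit below [e]. *)
Lemma orbit_meet_lower_bound e :
  0 [<=] e -> (forall x, `|x| <= 1 -> P x [<=] e) ->
  exists n (d : R), 0 < d /\ forall x, 0 [<=] x -> `|x| <= 1 ->
    d * `|x| <= \sum_(1 <= k < n.+1) `|meetE (iter k T x) e|.
Proof.
move=> e0 he; have [d d0 hd] := P_lower_bound.
have d2 : 0 < d / 2 by rewrite divr_gt0.
have [n n0 hn] := average_approx d2.
exists n, (d / 2); split => // x x0 x1.
have nR : 0 <= n%:R^-1 :> R by rewrite invr_ge0.
set s : E := \sum_(1 <= k < n.+1) meetE (iter k T x) e.
have h : P x [<=] s + absE (average n x - P x).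
  apply: vle_trans (_ : _ [<=] meetE (average n x) e + absE (average n x - P x)) _.
    apply: vle_addr; apply: vle_meet; apply: vle_subl.
      by rewrite (vabs_distC (V := V)); exact: vle_dist.
    by apply: vle_trans (he x x1) _; apply: vle_add; exact: vabs_ge0.
  apply: vleD2r.
  rewrite /average (scaler_sumr (V := E)).
  have := @vmeet_suml R V nat (index_iota 1 n.+1) xpredT
    (fun k => n%:R^-1 *: iter k T x) e e0.
  move=> hs; apply: vle_trans (hs _) _ => [k _|].
    by apply: vscale_ge0 => //; exact: iterT_pos.
  apply: vle_sum => k _; apply: vle_meet2; last exact: vle_refl.
  rewrite -[X in _ [<=] X]scale1r; apply: vleZl; last exact: iterT_pos.
  by rewrite invf_le1 ?ltr0n // ler1n.
have := bl_norm_le_pos (P_pos x0) h.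
have := ler_normD s (absE (average n x - P x)).
rewrite (@bl_norm_abs R E) => h1 h2.
have [h3 _] := hn x; have h4 := hd x x0.
apply: le_trans (_ : `|s| <= _); first lra.
exact: ler_norm_sum.
Qed.

(** ** The norm is additive up to a constant on the positive cone *)

(** On positive vectors the norm is comparable to [`|P x|], and all partial
    sums of the [P (y i)] stay bounded by the norm of the total. Collecting the
    indices where a given coordinate of [P (y i)] is positive, then those where
    it is negative, bounds the sum of the absolute values of that coordinate. *)
Lemma norm_superadditive : exists2 D : R, 0 <= D & forall k (y : nat -> E),
  (forall i, (i < k)%N -> 0 [<=] y i) ->
  \sum_(i < k) `|y i| <= D * `|\sum_(i < k) y i|.
Proof.
have [d d0 hd] := P_lower_bound.
have [r [b [fb hb]]] := fixed_basis.
have [C C0 hC] := free_family_coef_bound fb.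
exists (d^-1 * (2 * C * \sum_(l < r) `|b l|)) => [|k y y0].
  by rewrite !mulr_ge0 ?invr_ge0 ?sumr_ge0 // ltW.
set B := `|\sum_(i < k) y i|.
have /choice[g hg] : forall i, exists c, P (y i) = lincomb b r c.
  by move=> i; apply: hb; exact: TP.
have hQ (Q : pred 'I_k) l : (l < r)%N -> `|\sum_(i < k | Q i) g i l| <= C * B.
  move=> lr; pose c l' := \sum_(i < k | Q i) g i l'.
  apply: le_trans (hC c l lr) _; rewrite ler_pM2l //.
  have -> : lincomb b r c = P (\sum_(i < k | Q i) y i).
    rewrite linear_sum /lincomb /c.
    under eq_bigr do rewrite scaler_suml.
    by rewrite exchange_big; apply: eq_bigr => i _; rewrite hg.
  apply: le_trans (P_norm _) _; apply: bl_norm_le_pos.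
    by apply: vsum_ge0 => i _; exact: y0.
  rewrite [X in _ [<=] X](bigID Q) /=; apply: (@vle_add R V).
  by apply: vsum_ge0 => i _; exact: y0.
have hl l : (l < r)%N -> \sum_(i < k) `|g i l| <= 2 * (C * B).
  move=> lr; rewrite (bigID (fun i : 'I_k => 0 <= g i l)) /= mulr_natl mulr2n.
  apply: lerD.
    rewrite (eq_bigr (fun i : 'I_k => g i l)) => [|i]; last exact: ger0_norm.
    exact: le_trans (ler_norm _) (hQ _ _ lr).
  rewrite (eq_bigr (fun i : 'I_k => - g i l)) => [|i]; last first.
    by rewrite -ltNge => /ltr0_norm.
  by rewrite sumrN; apply: le_trans (ler_norm _) _; rewrite normrN; exact: hQ.
have hP : \sum_(i < k) `|P (y i)| <= 2 * C * (\sum_(l < r) `|b l|) * B.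
  apply: (@le_trans _ _ (\sum_(i < k) \sum_(l < r) `|g i l| * `|b l|)).
    apply: ler_sum => i _; rewrite hg; apply: le_trans (ler_norm_sum _ _ _) _.
    by apply: ler_sum => l _; rewrite normrZ.
  rewrite exchange_big /=.
  have -> : 2 * C * (\sum_(l < r) `|b l|) * B =
      \sum_(l < r) (2 * (C * B)) * `|b l|.
    by rewrite -mulr_sumr; ring.
  apply: ler_sum => l _; rewrite -mulr_suml; apply: ler_wpM2r => //.
  exact: hl.
rewrite -[X in _ <= X]mulrA ler_pdivlMl // mulr_sumr; apply: le_trans hP.
by apply: ler_sum => i _; apply: hd; exact: y0.
Qed.

(** ** Asymptotic orbits *)

(** Modulo null sequences these form the completed direct limit of
    [E -> E -> E -> ...] along [T], on which [T] acts as a lattice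
    automorphism, namely the shift. *)
Definition asymptotic_orbit (x : nat -> E) : Prop := forall eps : R, 0 < eps ->
  exists N, forall n, (N <= n)%N -> forall k,
  `|iter k T (x n) - x (n + k)%N| <= eps.

Implicit Types u v : nat -> E.

Lemma asymptotic_orbit_iter x : asymptotic_orbit (fun n => iter n T x).
Proof.
move=> e e0; exists 0 => n _ k.
by rewrite -iterD addnC subrr normr0 ltW.
Qed.

Lemma asymptotic_orbit_fixed x : T x = x -> asymptotic_orbit (fun=> x).
Proof.
move=> Tx e e0; exists 0 => n _ k.
have -> : iter k T x = x by elim: k => //= k ->.
by rewrite subrr normr0 ltW.
Qed.

Lemma asymptotic_orbitD u v : asymptotic_orbit u -> asymptotic_orbit v ->
  asymptotic_orbit (fun n => u n + v n).
Proof.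
move=> hu hv e e0; have e2 : 0 < e / 2 by rewrite divr_gt0.
have [N hN] := hu _ e2; have [N' hN'] := hv _ e2.
exists (maxn N N') => n; rewrite geq_max => /andP[n1 n2] k.
rewrite iterTD opprD addrACA; apply: le_trans (ler_normD _ _) _.
have := hN _ n1 k; have := hN' _ n2 k; lra.
Qed.

Lemma asymptotic_orbitZ (a : R) u : asymptotic_orbit u ->
  asymptotic_orbit (fun n => a *: u n).
Proof.
move=> hu e e0; have a1 : 0 < `|a| + 1 by rewrite ltr_wpDl.
have [N hN] := hu _ (divr_gt0 e0 a1); exists N => n Nn k.
rewrite iterTZ -scalerBr normrZ.
have := hN n Nn k; rewrite ler_pdivlMr // => h; apply: le_trans h.
by rewrite mulrC ler_wpM2l // lerDl.
Qed.

Lemma asymptotic_orbit_norm_cvg u : asymptotic_orbit u ->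
  cvgn (fun n => `|u n|).
Proof.
move=> hu; apply/cauchy_cvgP; apply: cauchy_exP => e e0.
have e2 : 0 < e / 2 by rewrite divr_gt0.
have [N hN] := hu _ e2; exists `|u N|.
exists N => // n /= Nn; rewrite /ball /=.
have := hN N (leqnn N) (n - N)%N; rewrite subnKC // => h.
rewrite -(iterT_iso (n - N) (u N)); apply: le_lt_trans (ler_dist_dist _ _) _.
by lra.
Qed.

Lemma positive_part_drift u n k :
  P (absE (u (n + k)%N)) [<=]
  P (absE (u n)) + P (absE (iter k T (u n) - u (n + k)%N)).
Proof.
rewrite -(P_iterT k (absE (u n))) -linearD; apply: P_le.
rewrite (vabs_distC (V := V)).
apply: vle_trans (_ : _ [<=] absE (iter k T (u n)) +
    absE (u (n + k)%N - iter k T (u n))) _.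
  rewrite -{1}(subrK (iter k T (u n)) (u (n + k)%N)) addrC; exact: vabsD.
by apply: vleD2r; exact: iterT_abs.
Qed.

(** The sequence [P (absE (u n))] decreases up to small errors and lives in a
    finite-dimensional space, so it cannot leave any of its cluster points. *)
Lemma P_abs_cauchy u : asymptotic_orbit u -> forall eps : R, 0 < eps ->
  exists N, forall n m, (N <= n)%N -> (N <= m)%N ->
  `|P (absE (u n)) - P (absE (u m))| <= eps.
Proof.
move=> hu e e0; pose a n := P (absE (u n)).
have [r [b [fb hb]]] := fixed_basis.
have [N0 hN0] := hu 1 ltr01.
have [A Ac hA] := free_family_compact (`|u N0| + 1) fb.
have aA n : (N0 <= n)%N -> A (a n).
  move=> Nn; have [c hc] := hb _ (TP (absE (u n))); rewrite /a hc; apply: hA.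
  rewrite -hc; apply: le_trans (P_norm _) _; rewrite (@bl_norm_abs R E).
  have := hN0 N0 (leqnn _) (n - N0)%N; rewrite subnKC // distrC => h.
  rewrite -(subrK (iter (n - N0) T (u N0)) (u n)).
  by apply: le_trans (ler_normD _ _) _; rewrite iterT_iso addrC lerD2l.
have FA : (a n @[n --> \oo]) A by exists N0 => // n /= Nn; exact: aA.
have [l [_ hl]] := Ac _ _ FA.
have near_l (d : R) N : 0 < d -> exists2 n, (N <= n)%N & `|l - a n| < d.
  move=> d0; have [] := hl (a @` [set n | (N <= n)%N]) (ball l d).
  - by exists N => // n /= Nn; exists n.
  - exact: nbhsx_ballx.
  - by move=> _ [[n /= Nn <-]]; rewrite -ball_normE /= => h; exists n.
have e8 : 0 < e / 8 by rewrite divr_gt0.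
have [N hN] := hu _ e8.
have [n0 Nn0 hn0] := near_l _ N e8.
have rho n k : (N <= n)%N -> `|P (absE (iter k T (u n) - u (n + k)%N))| <= e / 8.
  move=> Nn; apply: le_trans (P_norm _) _; rewrite (@bl_norm_abs R E); exact: hN.
have close m : (n0 <= m)%N -> `|a m - a n0| <= e / 2.
  move=> n0m; have [q mq hq] := near_l _ m e8.
  set z1 := P (absE (iter (m - n0) T (u n0) - u m)).
  set z2 := P (absE (iter (q - m) T (u m) - u q)).
  have h1 : a m [<=] a n0 + z1.
    by have := positive_part_drift u n0 (m - n0); rewrite subnKC.
  have h2 : a q [<=] a m + z2.
    by have := positive_part_drift u m (q - m); rewrite subnKC.
  have z10 : 0 [<=] z1 by apply: P_pos; exact: vabs_ge0.
  have z20 : 0 [<=] z2 by apply: P_pos; exact: vabs_ge0.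
  have z1e : `|z1| <= e / 8 by have := rho n0 (m - n0)%N Nn0; rewrite subnKC.
  have z2e : `|z2| <= e / 8.
    by have := rho m (q - m)%N (leq_trans Nn0 n0m); rewrite subnKC.
  pose z : E := z1 + z2 + absE (a n0 - a q).
  have h : absE (a m - a n0) [<=] z.
    apply: vabs_dist.
      apply: vle_trans h1 _; apply: vleD; first exact: vle_refl.
      rewrite /z -addrA; apply: (@vle_add R V).
      by apply: vadd_ge0 => //; exact: vabs_ge0.
    apply: vle_trans (@vle_dist R V (a n0) (a q)) _.
    apply: vle_trans (vleD2r _ h2) _.
    rewrite -addrA; apply: vleD; first exact: vle_refl.
    by rewrite /z -addrA [X in _ [<=] X]addrC; exact: (@vle_add R V).
  rewrite -(@bl_norm_abs R E).
  apply: le_trans (bl_norm_le_pos (@vabs_ge0 R V _) h) _.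
  apply: le_trans (ler_normD _ _) _; rewrite (@bl_norm_abs R E).
  have := ler_normD z1 z2; have := ler_distD l (a n0) (a q).
  rewrite [`|a n0 - l|]distrC; lra.
exists n0 => n m nn0 mn0; have := ler_distD (a n0) (a n) (a m).
rewrite [`|a n0 - a m|]distrC; have := close n nn0; have := close m mn0; lra.
Qed.

(** Hence the defect [T^k |u n| - |T^k (u n)|], a positive vector whose image
    under [P] is small, is itself small: asymptotic orbits form a lattice. *)
Lemma asymptotic_orbit_abs u : asymptotic_orbit u ->
  asymptotic_orbit (fun n => absE (u n)).
Proof.
move=> hu e e0; have [d d0 hd] := P_lower_bound.
have c0 : 0 < 1 + 2 / d by rewrite addr_gt0 // divr_gt0.
set e1 := e / (1 + 2 / d); have e10 : 0 < e1 by rewrite divr_gt0.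
have eE : e1 + 2 * e1 / d = e by rewrite /e1; field; lra.
have [N hN] := hu _ e10; have [N' hN'] := P_abs_cauchy hu e10.
exists (maxn N N') => n; rewrite geq_max => /andP[Nn N'n] k.
set w := u (n + k)%N; set z := iter k T (u n).
have zw : `|absE w - absE z| <= e1.
  apply: le_trans (_ : `|z - w| <= e1); last exact: hN.
  rewrite distrC; apply: bl_norm_vle; exact: vabs_distabs.
have g0 : 0 [<=] iter k T (absE (u n)) - absE z.
  by apply: vsub_ge0; exact: iterT_abs.
have h1 : `|iter k T (absE (u n)) - absE z| <= 2 * e1 / d.
  rewrite ler_pdivlMr // mulrC; apply: le_trans (hd _ g0) _.
  rewrite linearB P_iterT.
  have -> : P (absE (u n)) - P (absE z) =
      (P (absE (u n)) - P (absE w)) + P (absE w - absE z).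
    by rewrite linearB addrA subrK.
  apply: le_trans (ler_normD _ _) _.
  have := hN' n (n + k)%N N'n (leq_trans N'n (leq_addr _ _)).
  have := le_trans (P_norm _) zw; rewrite -/w; lra.
have -> : iter k T (absE (u n)) - absE w =
    (iter k T (absE (u n)) - absE z) - (absE w - absE z).
  by rewrite opprB addrA subrK.
apply: le_trans (ler_normB _ _) _; lra.
Qed.

(** ** The limit seminorm *)

Local Notation W := (sequence_vectorLattice E).

Definition limit_norm u : R := limn (fun n => `|u n|).

Lemma limit_norm_cvg u : asymptotic_orbit u ->
  `|u n| @[n --> \oo] --> limit_norm u.
Proof. exact: asymptotic_orbit_norm_cvg. Qed.

Lemma limit_norm_cst u (a : R) : (forall n, `|u n| = a) -> limit_norm u = a.
Proof.
move=> h; rewrite /limit_norm.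
have -> : (fun n => `|u n|) = (fun=> a) by apply/funext.
exact: lim_cst.
Qed.

Lemma limit_norm_le_sum u v w : asymptotic_orbit u -> asymptotic_orbit v ->
  asymptotic_orbit w -> (forall n, `|u n| <= `|v n| + `|w n|) ->
  limit_norm u <= limit_norm v + limit_norm w.
Proof.
move=> hu hv hw h.
apply: (ler_cvg_to (limit_norm_cvg hu)
  (cvgD (limit_norm_cvg hv) (limit_norm_cvg hw))).
by apply: nearW => n; exact: h.
Qed.

Definition limit_seminorm : rieszSeminorm W.
Proof.
refine (@RieszSeminorm R W asymptotic_orbit limit_norm _ _ _ _ _ _).
- exact: asymptotic_orbitD.
- exact: asymptotic_orbitZ.
- exact: asymptotic_orbit_abs.
- move=> u v hu hv; apply: limit_norm_le_sum => //.
    exact: asymptotic_orbitD.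
  by move=> n; exact: ler_normD.
- move=> a u hu; apply: cvg_lim => //.
  have -> : (fun n => `|(a *: u : nat -> E) n|) = (fun n => `|a| * `|u n|).
    by apply/funext => n; rewrite -normrZ.
  exact: cvgMr (limit_norm_cvg hu).
- move=> u v hu hv huv.
  apply: (ler_cvg_to (limit_norm_cvg hu) (limit_norm_cvg hv)).
  by apply: nearW => n; apply: bl_norm_vle; exact: huv.
Defined.
Local Notation p := limit_seminorm.

Lemma limit_seminorm_dom0 : rs_dom p 0.
Proof. exact: rs_dom0 (asymptotic_orbit_iter 0 : rs_dom p _). Qed.

Lemma cvg_sumr (I : Type) (r : seq I) (f : I -> nat -> R) (l : I -> R) :
  (forall i, f i n @[n --> \oo] --> l i) ->
  \sum_(i <- r) f i n @[n --> \oo] --> \sum_(i <- r) l i.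
Proof.
move=> h; apply: cvg_big => [|i _]; [exact: add_continuous|exact: h].
Qed.

Lemma limit_norm_superadditive : exists2 D : R, 0 <= D & forall k (y : nat -> W),
  (forall i, (i < k)%N -> asymptotic_orbit (y i)) ->
  (forall i, (i < k)%N -> vle 0 (y i)) ->
  \sum_(i < k) p (y i) <= D * p (\sum_(i < k) y i).
Proof.
have [D D0 hD] := norm_superadditive; exists D => // k y hy y0.
have hS : asymptotic_orbit (\sum_(i < k) y i : W).
  apply: (@rs_dom_sum R W p) => [|i _]; last exact: hy.
  exact: limit_seminorm_dom0.
apply: (ler_cvg_to (cvg_sumr (fun i : 'I_k => limit_norm_cvg (hy i (ltn_ord i))))
   (cvgMr (limit_norm_cvg hS))).
apply: nearW => n; have := hD k (fun i => y i n) (fun i ik => y0 i ik n).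
by congr (_ <= _ * `|_|); rewrite fct_sumE.
Qed.

(** In the limit [vmeet (T^k (u n)) e] has the norm of [vmeet (u (n + k)) e],
    that is the seminorm of [vmeet u e], for every [k]; so the orbit estimate
    bounds that seminorm from below.
    Seminorm [1 / 2] places [u n] in the unit ball for large [n]. *)
Lemma limit_norm_meet (e : E) : 0 [<=] e -> T e = e ->
  (forall x, `|x| <= 1 -> P x [<=] e) ->
  exists2 d : R, 0 < d & forall u : W, asymptotic_orbit u -> vle 0 u ->
    p u = 2^-1 -> d <= p (vmeet u (fun=> e : E)).
Proof.
move=> e0 Te he; have [n [d [d0 hd]]] := orbit_meet_lower_bound e0 he.
have n1 : 0 < (n.+1)%:R :> R by rewrite ltr0n.
exists (d * 2^-1 / n.+1%:R).
  by rewrite !mulr_gt0 ?invr_gt0.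
move=> u hu u0 pu; rewrite ler_pdivrMr //.
have he' : asymptotic_orbit (fun=> e : E).
  exact: asymptotic_orbit_fixed.
pose y : W := vmeet u (fun=> e : E).
have hy : asymptotic_orbit y by exact: (@rs_dom_meet R W p).
have py0 : 0 <= p y by exact: rs_ge0.
have small k : `|iter k T (u m) - u (m + k)%N| @[m --> \oo] --> (0 : R).
  apply/cvgrPdist_le => c c0; have [N hN] := hu c c0.
  exists N => // m /= Nm; rewrite sub0r normrN normr_id; exact: hN.
have shift k : `|y (m + k)%N| @[m --> \oo] --> p y.
  have := limit_norm_cvg hy; rewrite -(cvg_shiftn k); exact.
have lhs : d * `|u m| @[m --> \oo] --> d * 2^-1.
  by rewrite -pu; exact: cvgMr (limit_norm_cvg hu).
have rhs : \sum_(1 <= k < n.+1) (`|y (m + k)%N| +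
    `|iter k T (u m) - u (m + k)%N|) @[m --> \oo] -->
    \sum_(1 <= k < n.+1) (p y + 0).
  by apply: cvg_sumr => k; exact: cvgD.
have : d * 2^-1 <= \sum_(1 <= k < n.+1) (p y + 0).
  apply: (ler_cvg_to lhs rhs).
  have u1 : \forall m \near \oo, `|u m| <= 1.
    have := limit_norm_cvg hu; rewrite [limit_norm u]pu.
    move=> /cvgrPdist_le /(_ 2^-1); rewrite invr_gt0 => /(_ (ltr0Sn _ 1)).
    apply: filterS => m; rewrite distrC.
    have := ler_norm (`|u m| - 2^-1); lra.
  apply: filterS u1 => m um1.
  apply: le_trans (hd _ (u0 m) um1) _; apply: ler_sum => k _.
  rewrite -lerBlDl; apply: le_trans (lerB_dist _ _) _.
  apply: bl_norm_vle; exact: vmeet_dist.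
move=> h; apply: le_trans h _.
rewrite addr0 sumr_const_nat subn1 -(mulr_natr (p y)).
by apply: ler_wpM2l; [exact: py0|rewrite ler_nat].
Qed.

(** Rescaled to seminorm [1 / 2] and cut off at [e], the members of a disjoint
    system keep a seminorm bounded below, while their sum is at most [e] up to
    a null element. *)
Lemma disjoint_systems_bounded : exists K, forall k (x : nat -> W),
  disjoint_system p k x -> (k <= K)%N.
Proof.
have [e [e0 Te he]] := dominating_fixed_vector.
have [d d0 hd] := limit_norm_meet e0 Te he.
have [D D0 hD] := limit_norm_superadditive.
exists (Num.bound (D * `|e| / d)) => k x [h1 h2].
have he' : asymptotic_orbit (fun=> e : E).
  exact: asymptotic_orbit_fixed.
pose t i := (2 * p (x i))^-1.
pose y i : W := vmeet (t i *: x i) (fun=> e : E).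
have t0 i : (i < k)%N -> 0 < t i.
  by move=> /h1[_ _ px]; rewrite invr_gt0 mulr_gt0.
have hz i : (i < k)%N -> asymptotic_orbit (t i *: x i : W).
  by move=> /h1[hx _ _]; exact: asymptotic_orbitZ.
have z0 i : (i < k)%N -> vle 0 (t i *: x i : W).
  by move=> ik; have [_ x0 _] := h1 i ik; apply: vscale_ge0 => //; exact/ltW/t0.
have hy i : (i < k)%N -> asymptotic_orbit (y i).
  by move=> ik; apply: (@rs_dom_meet R W p) => //; exact: hz.
have y0 i : (i < k)%N -> vle 0 (y i).
  by move=> ik; apply: vmeet_ge0; [exact: z0|move=> n; exact: e0].
have ye i : (i < k)%N -> vle (y i) (fun=> e : E) by move=> _; exact: vmeet_ler.
have py i : (i < k)%N -> d <= p (y i).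
  move=> ik; apply: hd; [exact: hz|exact: z0|].
  have [hx _ px] := h1 i ik.
  rewrite rsZ // gtr0_norm ?t0 // /t invfM -mulrA mulVf ?mulr1 // gt_eqF //.
have disj i j : (i < k)%N -> (j < k)%N -> i != j -> p (vmeet (y i) (y j)) = 0.
  move=> ik jk ij; have [hxi xi0 _] := h1 i ik; have [hxj xj0 _] := h1 j jk.
  pose s := t i + t j.
  have s0 : 0 <= s by rewrite addr_ge0 // ltW // t0.
  have hm : rs_dom p (vmeet (x i) (x j)) by exact: rs_dom_meet.
  apply: (rs_eq0 (y := s *: vmeet (x i) (x j))).
  - by apply: rs_dom_meet; exact: hy.
  - exact: rs_domZ.
  - by apply: vmeet_ge0; exact: y0.
  - rewrite vmeetZ //; apply: vle_meet2; apply: vle_trans (vmeet_lel _ _) _;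
      apply: vleZl => //; rewrite ?lerDl ?lerDr ltW // t0 //.
  - by rewrite rsZ // h2 // mulr0.
have M0 := limit_seminorm_dom0.
have hover : rs_dom p (\sum_(i < k) \sum_(j < i) vmeet (y j) (y i)).
  apply: rs_dom_sum => // i _; apply: rs_dom_sum => // j _.
  by apply: rs_dom_meet; apply: hy => //; exact: ltn_trans (ltn_ord i).
have : \sum_(i < k) p (y i) <= D * `|e|.
  apply: le_trans (hD k y hy y0) _.
  apply: ler_wpM2l => //.
  have pe : p (fun=> e : E) = `|e| by exact: limit_norm_cst.
  rewrite -pe; apply: (@le_trans _ _ (p ((fun=> e : E) +
      \sum_(i < k) \sum_(j < i) vmeet (y j) (y i) : W))).
    apply: rs_le_pos.
    - by apply: rs_dom_sum => // i _; exact: hy.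
    - exact: rs_domD.
    - by apply: vsum_ge0 => i _; exact: y0.
    - by apply: vsum_le_overlap => //; move=> n; exact: e0.
  apply: le_trans (@rsD R W p _ _ he' hover) _; rewrite gerDl.
  apply: (@le_trans _ _ (\sum_(i < k) \sum_(j < i) p (vmeet (y j) (y i)))).
    apply: (@le_trans _ _ (\sum_(i < k) p (\sum_(j < i) vmeet (y j) (y i)))).
      apply: rs_sum => // i _; apply: rs_dom_sum => // j _.
      by apply: rs_dom_meet; apply: hy => //; exact: ltn_trans (ltn_ord i).
    apply: ler_sum => i _; apply: rs_sum => // j _.
    by apply: rs_dom_meet; apply: hy => //; exact: ltn_trans (ltn_ord i).
  rewrite big1 // => i _; rewrite big1 // => j _.
  apply: disj => //; first exact: ltn_trans (ltn_ord i).
  by rewrite ltn_eqF.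
move=> h; rewrite -(ler_nat R); apply/ltW.
apply: le_lt_trans (archi_boundP _); last by rewrite divr_ge0 ?mulr_ge0 // ltW.
rewrite ler_pdivlMr //; apply: le_trans h.
rewrite mulr_natl -[X in _ *+ X]card_ord -sumr_const.
by apply: ler_sum => i _; exact: py.
Qed.

(** Modulo null sequences the orbits of vectors of [E] form an isometric copy
    of [E] inside the span of finitely many atoms. *)
Theorem uniformly_ergodic_isometry_findim :
  exists K, forall b : nat -> E, dependent_family b K.
Proof.
have [K hK] := disjoint_systems_bounded.
have M0 := limit_seminorm_dom0.
have [k [x [hx hs]]] := bounded_disjoint_systems_span M0 hK.
exists k.+1 => b.
pose o f : W := fun n => iter n T f.
have ho f : rs_dom p (o f) by exact: asymptotic_orbit_iter.
have /choice[s hbs] : forall j, exists s : nat -> R,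
    p (o (b j) - \sum_(i < k) s i *: x i) = 0 by move=> j; exact: hs.
have hxs j : rs_dom p (\sum_(i < k) s j i *: x i).
  by apply: rs_dom_sum => // i _; apply: rs_domZ; exact: hx.
have [a a0 ha] := @wide_relation R k (fun j (i : 'I_k) => s j i); exists a => //.
apply/eqP; rewrite -normr_eq0; apply/eqP.
have <- : p (o (lincomb b k.+1 a)) = `|lincomb b k.+1 a|.
  by apply: limit_norm_cst => n; exact: iterT_iso.
have -> : o (lincomb b k.+1 a) =
    \sum_(j < k.+1) a j *: (o (b j) - \sum_(i < k) s j i *: x i).
  rewrite (eq_bigr (fun j : 'I_k.+1 => a j *: o (b j) -
    \sum_(i < k) (a j * s j i) *: x i)) => [|j _]; last first.
    rewrite scalerBr scaler_sumr; congr (_ - _).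
    by apply: eq_bigr => i _; rewrite scalerA.
  rewrite sumrB exchange_big /= [X in _ - X]big1 => [|i _]; last first.
    by rewrite -scaler_suml ha // scale0r.
  rewrite subr0; apply/funext => n; rewrite fct_sumE /o /lincomb iterT_sum.
  by apply: eq_bigr => j _; rewrite iterTZ.
have hj j : rs_dom p (a j *: (o (b j) - \sum_(i < k) s j i *: x i)).
  by apply: rs_domZ; apply: rs_domB.
apply/eqP; rewrite eq_le rs_ge0 ?andbT; last exact: rs_dom_sum.
apply: (@le_trans _ _ (\sum_(j < k.+1)
    p (a j *: (o (b j) - \sum_(i < k) s j i *: x i)))).
  by apply: rs_sum.
rewrite big1 // => j _; rewrite rsZ ?hbs ?mulr0 //.
exact: rs_domB.
Qed.

End UniformlyErgodic.

(** * Complexification *)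

Section Complexification.
Local Notation "x [<=] y" := (vle x y) (at level 70, no associativity).
Variables (R : realType) (L : complexBanachLattice R).
Local Notation E := (cbl_real L).
Local Notation V := (banach_vectorLattice E).
Local Notation emb := (@cbl_emb R L).
Local Open Scope complex_scope.
Implicit Types (x y : E) (f : L).

Lemma emb0 : emb 0 = 0.
Proof. by rewrite -(scale0r (0 : E)) cbl_embZ scale0r. Qed.

Lemma embN x : emb (- x) = - emb x.
Proof. by rewrite -scaleN1r cbl_embZ rmorphN1 scaleN1r. Qed.

Lemma embB x y : emb (x - y) = emb x - emb y.
Proof. by rewrite cbl_embD embN. Qed.

Lemma emb_sum (I : Type) (r : seq I) (Q : pred I) (g : I -> E) :
  emb (\sum_(i <- r | Q i) g i) = \sum_(i <- r | Q i) emb (g i).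
Proof.
by elim/big_ind2: _ => [|x f y f' <- <-|//]; [exact: emb0|exact: cbl_embD].
Qed.

Lemma emb_decomp f : exists x y, f = emb x + 'i *: emb y.
Proof.
have [g _ gK] := cbl_emb_bij L.
by exists (g f).1, (g f).2; rewrite -[LHS](gK f).
Qed.

Lemma emb_decomp_inj x y x' y' :
  emb x + 'i *: emb y = emb x' + 'i *: emb y' -> x = x' /\ y = y'.
Proof. by move=> /(bij_inj (cbl_emb_bij L) (x1 := (x, y)) (x2 := (x', y')))[]. Qed.

Lemma emb_inj : injective emb.
Proof.
by move=> x y xy; have [] : x = y /\ 0 = 0 :> E by apply: emb_decomp_inj; rewrite xy.
Qed.

(** For [y = 0] the supremum defining the modulus is the absolute value of [x],
    already attained by the angles [0] and [pi]. *)
Lemma emb_norm x : `|emb x| = `|x|%:C.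
Proof.
have [m [ub lub] h] := cbl_norm x 0.
rewrite emb0 scaler0 addr0 in h; rewrite h; congr (_%:C).
have xm : @vabs R V x [<=] m.
  apply: vabs_le; apply: ub.
    by exists 0 => //; rewrite cos0 scale1r scaler0 addr0.
  by exists pi => //; rewrite cospi scaleN1r scaler0 addr0.
have mx : (m : V) [<=] @vabs R V x.
  apply: lub => _ [t _ <-]; rewrite scaler0 addr0.
  apply: (vle_trans (@vle_abs R V _)); rewrite vabsZ.
  rewrite -[X in _ [<=] X]scale1r; apply: vleZl; last exact: vabs_ge0.
  exact: cos_max.
by rewrite -(vle_anti xm mx) bl_norm_abs.
Qed.

(** The angles [pi / 2] and [- pi / 2] show that the modulus dominates [y] and
    [- y]. *)
Lemma emb_norm_im x y : `|y| <= complex.Re `|emb x + 'i *: emb y|.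
Proof.
have [m [ub _] ->] := cbl_norm x y; rewrite /=.
have ym : @vabs R V y [<=] m.
  apply: vabs_le; apply: ub.
    by exists (pi / 2) => //; rewrite cos_pihalf sin_pihalf scale0r add0r scale1r.
  exists (- (pi / 2)) => //.
  by rewrite cosN sinN cos_pihalf sin_pihalf scale0r add0r scaleN1r.
rewrite -(@bl_norm_abs R E y); apply: bl_norm_le_pos ym; exact: vabs_ge0.
Qed.

Lemma complex_scale_decomp (c : R[i]) x y : c *: (emb x + 'i *: emb y) =
  emb (complex.Re c *: x - complex.Im c *: y) +
  'i *: emb (complex.Im c *: x + complex.Re c *: y).
Proof.
rewrite embB cbl_embD !cbl_embZ {1}[c]complexE scalerDl !scalerDr !scalerA.
have -> : 'i * (complex.Im c)%:C * 'i = - (complex.Im c)%:C :> R[i].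
  by rewrite mulrAC -expr2 sqr_i mulN1r.
rewrite scaleNr ['i * (complex.Re c)%:C]mulrC.
by rewrite [X in _ + X = _]addrC addrACA [X in _ + X = _]addrC.
Qed.

End Complexification.

(** ** Linear maps preserving the real part *)

Section RealPart.
Variables (R : realType) (L : complexBanachLattice R) (S : {linear L -> L}).
Local Notation emb := (@cbl_emb R L).

Lemma real_part_linear (s : cbl_real L -> cbl_real L) :
  (forall x, S (emb x) = emb (s x)) -> linear s.
Proof.
move=> h a x y; apply: emb_inj.
by rewrite -h !cbl_embD !cbl_embZ linearD linearZ /= !h.
Qed.

Lemma real_part_exists :
  (forall x, exists y, S (emb x) = emb y) ->
  exists s : {linear cbl_real L -> cbl_real L}, forall x, S (emb x) = emb (s x).
Proof.
move=> /choice[s hs].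
pose sM := GRing.isLinear.Build R (cbl_real L) (cbl_real L) *:%R s
  (real_part_linear hs).
by exists (HB.pack_for {linear cbl_real L -> cbl_real L} s sM).
Qed.

End RealPart.

Lemma positive_operator_real (R : realType) (L : complexBanachLattice R)
    (T : {linear L -> L}) : positive_operator T ->
  forall x, exists y, T (cbl_emb x) = @cbl_emb R L y.
Proof.
move=> Tpos x; pose V := banach_vectorLattice (cbl_real L).
have [y1 _ h1] := Tpos _ (@vpos_ge0 R V x).
have [y2 _ h2] := Tpos _ (@vpos_ge0 R V (- x)).
exists (y1 - y2); rewrite embB -h1 -h2 -linearB -embB.
by rewrite (@vpos_neg R V).
Qed.

(** The operator norm is a supremum over the unit ball; the estimate for a
    general [x] follows by rescaling. *)
Lemma uniformly_ergodic_estimate (R : realType) (L : complexBanachLattice R)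
    (T : {linear L -> L}) : uniformly_ergodic T ->
  exists P : {linear L -> L}, forall eps : R, 0 < eps -> exists N, forall n,
  (N <= n)%N -> forall x, complex.Re `|cesaro_mean T n (@cbl_emb R L x) -
    P (cbl_emb x)| <= eps * `|x|.
Proof.
move=> [P [_ cvP]]; exists P => eps e0.
have [N _ hN] : \forall n \near \oo,
    (opnorm (fun f => (cesaro_mean T n f - P f)%R) < eps%:E)%E.
  apply: (cvP [set z | (z < eps%:E)%E]).
  by apply: (@nbhs_open_ereal_lt R 0 (fun=> eps)).
exists N => n Nn x.
have [->|x0] := eqVneq x 0.
  rewrite emb0 linear0 subr0 /cesaro_mean big1 => [|k _]; last first.
    by elim: k => //= k ->; rewrite linear0.
  by rewrite scaler0 !normr0 mulr0.
have nx : 0 < `|x| by rewrite normr_gt0.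
have := hN n Nn; rewrite /= => hlt.
pose f := @cbl_emb R L (`|x|^-1 *: x).
have f1 : `|f| <= 1.
  by rewrite emb_norm normrZ normfV normr_id mulVf ?gt_eqF // rmorph1.
have : ((complex.Re `|cesaro_mean T n f - P f|)%:E <= eps%:E)%E.
  by apply: le_trans (ltW hlt); apply: ereal_sup_ubound; exists f.
rewrite lee_fin.
have -> : cesaro_mean T n f - P f = (`|x|^-1)%:C%C *:
    (cesaro_mean T n (cbl_emb x) - P (cbl_emb x)).
  rewrite /f cbl_embZ scalerBr linearZ; congr (_ - _).
  rewrite /cesaro_mean scalerA mulrC -scalerA; congr (_ *: _).
  rewrite scaler_sumr; apply: eq_bigr => k _.
  by elim: k => //= k ->; rewrite linearZ.
rewrite normrZ.
have -> : `|(`|x|^-1)%:C%C| = (`|x|^-1)%:C%C :> R[i].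
  by rewrite ger0_norm // lecR invr_ge0.
have -> (z : R[i]) : complex.Re ((`|x|^-1)%:C%C * z) = `|x|^-1 * complex.Re z.
  by case: z => a b; rewrite /= mul0r subr0.
by rewrite ler_pdivrMl // mulrC.
Qed.

(** The real and imaginary parts of [n] vectors spanning the fixed space of [T]
    span, over the reals, a space containing the fixed space of [t]. *)
Lemma real_fixed_findim (R : realType) (L : complexBanachLattice R)
    (T : {linear L -> L}) (t : {linear cbl_real L -> cbl_real L}) :
  (forall x, T (cbl_emb x) = cbl_emb (t x)) ->
  finite_dimensional (fixed_space T) ->
  exists K, forall b : nat -> cbl_real L,
  (forall i, (i < K)%N -> t (b i) = b i) -> dependent_family b K.
Proof.
move=> tT [n [B hB]].
have /choice[u /choice[v huv]] : forall i, exists x y,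
    B i = cbl_emb x + 'i *: @cbl_emb R L y.
  by move=> i; exact: emb_decomp.
pose g (i : 'I_(n + n)) := match fintype.split i with inl j => u j | inr j => v j end.
exists (n + n).+1 => b hb; apply: (span_dependent (g := g)) => i /hb tb.
have : fixed_space T (cbl_emb (b i)) by rewrite /fixed_space /= tT tb.
rewrite hB => -[c _ hc].
exists (fun l => match fintype.split l with inl j => complex.Re (c j)
                               | inr j => - complex.Im (c j) end).
rewrite big_split_ord /=.
have /emb_decomp_inj[-> _] : cbl_emb (b i) + 'i *: cbl_emb 0 =
    cbl_emb (\sum_(j < n) (complex.Re (c j) *: u j - complex.Im (c j) *: v j)) +
    'i *: @cbl_emb R L
      (\sum_(j < n) (complex.Im (c j) *: u j + complex.Re (c j) *: v j)).
  rewrite emb0 scaler0 addr0 -hc !emb_sum scaler_sumr -big_split /=.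
  by apply: eq_bigr => j _; rewrite huv complex_scale_decomp.
rewrite sumrB -sumrN; congr (_ + _); apply: eq_bigr => j _.
  by rewrite /g (unsplitK (inl j)).
by rewrite /g (unsplitK (inr j)) scaleNr.
Qed.

Lemma complex_findim (R : realType) (L : complexBanachLattice R) K :
  (forall b : nat -> cbl_real L, dependent_family b K) ->
  finite_dimensional [set: L].
Proof.
move=> dep; have [r [b [_ _ hb]]] :=
  @exists_basis _ _ (fun _ : cbl_real L => True) K (fun b _ => dep b).
exists r, (fun i => @cbl_emb R L (b i)); apply/esym/seteqP; split=> // f _.
have [x [y ->]] := emb_decomp f.
have [c ->] := hb x I; have [d ->] := hb y I.
exists (fun i : 'I_r => (c i)%:C%C + 'i * (d i)%:C%C) => //.
rewrite /lincomb !emb_sum scaler_sumr -big_split /=; apply: eq_bigr => i _.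
by rewrite scalerDl !cbl_embZ scalerA.
Qed.

Theorem theorem5p1 (R : realType) (L : complexBanachLattice R)
    (T : {linear L -> L}) :
  infinite_dimensional L ->
  positive_operator T ->
  isometry_operator T ->
  finite_dimensional (fixed_space T) ->
  ~ uniformly_ergodic T.
Proof.
move=> infL Tpos Tiso Tfix /uniformly_ergodic_estimate[P hP]; apply: infL.
have [t tT] := real_part_exists (positive_operator_real Tpos).
have cesaro_real n x : cesaro_mean T n (cbl_emb x) = cbl_emb (average t n x).
  rewrite /cesaro_mean /average cbl_embZ emb_sum fmorphV rmorph_nat.
  congr (_ *: _); apply: eq_bigr => k _.
  by elim: k => //= k ->; rewrite tT.
have Preal x : exists y, P (cbl_emb x) = @cbl_emb R L y.
  have [a [c Pac]] := emb_decomp (P (cbl_emb x)).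
  exists a; rewrite Pac; suff -> : c = 0 by rewrite emb0 scaler0 addr0.
  apply: (@norm_small_eq0 _ _ `|x|) => eps /hP[N /(_ N (leqnn N) x)].
  apply: le_trans; rewrite cesaro_real Pac opprD addrA -embB -scalerN -embN.
  by rewrite -normrN; exact: emb_norm_im.
have [p pP] := real_part_exists Preal.
have tpos x : bl_le 0 x -> bl_le 0 (t x).
  by move=> /Tpos[y y0]; rewrite tT => /emb_inj ->.
have tiso x : `|t x| = `|x|.
  by have := Tiso (cbl_emb x); rewrite tT !emb_norm => /complexI.
have terg (eps : R) : 0 < eps -> exists N, forall n, (N <= n)%N ->
    forall x, `|average t n x - p x| <= eps * `|x|.
  move=> /hP[N hN]; exists N => n Nn x; have := hN n Nn x.
  by rewrite cesaro_real pP -embB emb_norm.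
have [K hK] := @uniformly_ergodic_isometry_findim R (cbl_real L) t p tpos tiso
  terg (real_fixed_findim tT Tfix).
exact: complex_findim hK.
Qed.
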